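(* Let $F$ be a complex Finsler metric on a domain $D$ from $\mathbb{C}^n$. Then $F$ is locally projectively flat if and only if it is complex Berwald and $$G^{i}=\frac{1}{F}\frac{\partial F}{\partial z^{k}}\,\eta^{k}\eta^{i},$$ where $G^i$ are the spray coefficients of $F$.
   Context: Let $M$ be an $n$-dimensional complex manifold (here $M=D$), $z=(z^k)_{k=1,\dots,n}$ complex coordinates in a local chart, $T'M$ the holomorphic tangent bundle with induced local coordinates $(z^k,\eta^k)$, $\eta=\eta^k\frac{\partial}{\partial z^k}$. Summation over repeated indices is used; $\dot\partial_k=\partial/\partial\eta^k$, $\dot\partial_{\bar k}=\partial/\partial\bar\eta^k$, and barred indices denote complex conjugates. A complex Finsler metric on $M$ is a continuous function $F:T'M\to\mathbb{R}_{\ge 0}$, smooth on $T'M\setminus 0$, with $F(z,\eta)\ge 0$ and equality iff $\eta=0$, $F(z,\lambda\eta)=|\lambda|F(z,\eta)$ for all $\lambda\in\mathbb{C}$, and such that the Hermitian matrix $g_{i\bar j}=\frac{\partial^2F^2}{\partial\eta^i\partial\bar\eta^j}$ (the fundamental metric tensor) is positive definite; $(g^{\bar m i})$ is its inverse. The Chern–Finsler complex nonlinear connection has coefficients $N^i_j=g^{\bar m i}\frac{\partial g_{l\bar m}}{\partial z^j}\eta^l$; $L^i_{jk}=\dot\partial_jN^i_k$; the spray coefficients are given by $2G^i=N^i_j\eta^j$; and $\theta^{*i}=g^{\bar m i}g_{h\bar p}(L^{\bar p}_{\bar j\bar m}-L^{\bar p}_{\bar m\bar j})\eta^h\bar\eta^j$,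 where $L^{\bar p}_{\bar j\bar m}=\overline{L^p_{jm}}$. $F$ is generalized Berwald if $\dot\partial_{\bar h}G^i=0$ for all $h,i$ (the $G^i$ are holomorphic in $\eta$); weakly Kähler if $g_{i\bar l}(L^i_{jk}-L^i_{kj})\eta^j\bar\eta^l=0$; complex Berwald if and only if it is generalized Berwald and weakly Kähler. Geodesic curves $\gamma$ of $F$ satisfy $\frac{d^2\gamma^k}{dt^2}+2G^k(\gamma,\frac{d\gamma}{dt})=\theta^{*k}(\gamma,\frac{d\gamma}{dt})$. Two complex Finsler metrics $F,\tilde F$ on the same manifold are projectively related if any complex geodesic curve of the former is also a complex geodesic curve of the latter as point sets, and vice versa; this means that $\tilde G^i=G^i+\frac12(\tilde\theta^{*i}-\theta^{*i})+P\eta^i$ for some smooth complex-valued function $P$ on $T'M$. A complex Finsler metric $\tilde F$ on $M$ is locally Minkowski if at any point of $M$ there exist local charts in which its fundamental metric tensor $\tilde g_{i\bar j}$ depends only on $\eta$. A complex Finsler metric is locally projectively flat if it is projectively related to a locally Minkowski complex Finsler metric on the same manifold.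
   Formalization: The local charts in ''locally Minkowski'' are taken to be affine coordinate systems of C^n; with arbitrary holomorphic charts the formula fails, e.g. for F^2=|η^1|^2+|η^2+2z^1η^1|^2 on C^2, flat in the chart (z^1, z^2+(z^1)^2), where G=(0,(η^1)^2). *)

(* Defs.v *)
(* MathComp / MathComp-Analysis: complex Finsler metrics on a domain of C^n,
   with C = R[i] for R : realType. *)
From HB Require Import structures.
From mathcomp Require Import all_boot all_order all_algebra.
From mathcomp Require Import complex.
From mathcomp Require Import all_classical all_reals all_analysis.

Set Implicit Arguments.
Unset Strict Implicit.
Unset Printing Implicit Defensive.

Import Order.TTheory GRing.Theory Num.Theory.
Import numFieldNormedType.Exports.

Local Open Scope classical_set_scope.
Local Open Scope ring_scope.

(* Going through numFieldType is what gives C, C^n and C^n x C^n their usual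
   topologies. *)
Definition Cplx (R : realType) : numFieldType := R[i].

Definition toC (R : realType) (x : R) : Cplx R := (x%:C)%C.
Definition conjC (R : realType) (x : Cplx R) : Cplx R := (x^*)%C.
Definition iC (R : realType) : Cplx R := ('i)%C.

Section Calculus.
Variables (R : realType) (n : nat).
Local Notation C := (Cplx R).
Local Notation vec := ('rV[Cplx R]_n).
Local Notation T := ('rV[Cplx R]_n * 'rV[Cplx R]_n)%type.

Definition domain (D : set vec) : Prop :=
  [/\ open D, connected D & D !=set0].

(* T'D = D x C^n, with points p = (z, eta), and T'D \ 0. *)
Definition tangent (D : set vec) : set T := [set p | D p.1].
Definition slit_tangent (D : set vec) : set T := [set p | D p.1 /\ p.2 != 0].

(* Real directional derivative: v is a vector of the underlying real space. *)
Definition real_line (f : T -> R) (p v : T) : R -> R :=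
  fun t => f (p + toC t *: v).
Definition rderivable (f : T -> R) (p v : T) : Prop :=
  derivable (real_line f p v) 0 1.
Definition rderive (f : T -> R) (v : T) : T -> R :=
  fun p => derive1 (real_line f p v) 0.

(* Class C^k, resp. C^oo, on an open set O in the sense of real variables. *)
Fixpoint Ck (k : nat) (O : set T) (f : T -> R) : Prop :=
  (forall p, O p -> {for p, continuous f}) /\
  if k is k'.+1 then
    forall v : T, (forall p, O p -> rderivable f p v) /\ Ck k' O (rderive f v)
  else True.
Definition smooth (O : set T) (f : T -> R) : Prop := forall k, Ck k O f.
Definition csmooth (O : set T) (f : T -> C) : Prop :=
  smooth O (fun p => complex.Re (f p)) /\ smooth O (fun p => complex.Im (f p)).

Definition cderive (f : T -> C) (v p : T) : C :=
  toC (rderive (fun q => complex.Re (f q)) v p) +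
  iC R * toC (rderive (fun q => complex.Im (f q)) v p).

(* Wirtinger derivatives (d_x - i d_y)/2 and (d_x + i d_y)/2 along the complex
   coordinate with unit vector e. *)
Definition wirt (e : T) (f : T -> C) (p : T) : C :=
  (cderive f e p - iC R * cderive f (iC R *: e) p) / 2%:R.
Definition wirtb (e : T) (f : T -> C) (p : T) : C :=
  (cderive f e p + iC R * cderive f (iC R *: e) p) / 2%:R.

Definition unit_vec (k : 'I_n) : vec := delta_mx 0 k.

(* d/dz^k, d/deta^k and d/d(conj eta^k). *)
Definition dz (k : 'I_n) := wirt (unit_vec k, 0).
Definition deta (k : 'I_n) := wirt (0, unit_vec k).
Definition detab (k : 'I_n) := wirtb (0, unit_vec k).

End Calculus.

Section Finsler.
Variables (R : realType) (n : nat).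
Local Notation C := (Cplx R).
Local Notation vec := ('rV[Cplx R]_n).
Local Notation T := ('rV[Cplx R]_n * 'rV[Cplx R]_n)%type.

Definition sqF (F : T -> R) : T -> C := fun p => toC (F p ^+ 2).

(* Row i, column j is g_{i jbar}. *)
Definition fundamental (F : T -> R) (p : T) : 'M[C]_n :=
  \matrix_(i, j) deta i (detab j (sqF F)) p.

(* g^{m-bar i}, normalized by sum_m g_{j m-bar} g^{m-bar i} = delta_{ij}. *)
Definition ginv (F : T -> R) (p : T) (m i : 'I_n) : C :=
  invmx (fundamental F p) m i.

(* In the order of R[i], 0 < x says that x is real and positive, so the last
   clause contains the Hermitian symmetry of g. *)
Definition complex_Finsler (D : set vec) (F : T -> R) : Prop :=
  [/\ forall p, tangent D p -> {for p, continuous F},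
      smooth (slit_tangent D) F,
      forall z eta, D z -> 0 <= F (z, eta) /\ (F (z, eta) = 0 <-> eta = 0),
      forall z eta (lambda : C), D z ->
        toC (F (z, lambda *: eta)) = `|lambda| * toC (F (z, eta)) &
      forall p, slit_tangent D p -> forall v : vec, v != 0 ->
        0 < \sum_i \sum_j fundamental F p i j * v 0 i * conjC (v 0 j)].

(* Chern-Finsler connection N^i_j. *)
Definition CF (F : T -> R) (i j : 'I_n) (p : T) : C :=
  \sum_m \sum_l
    ginv F p m i * dz j (fun q => fundamental F q l m) p * p.2 0 l.

(* L^i_{jk}. *)
Definition CFL (F : T -> R) (i j k : 'I_n) (p : T) : C := deta j (CF F i k) p.

(* Spray coefficients G^i. *)
Definition spray (F : T -> R) (i : 'I_n) (p : T) : C :=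
  (\sum_j CF F i j p * p.2 0 j) / 2%:R.

Definition theta (F : T -> R) (i : 'I_n) (p : T) : C :=
  \sum_m \sum_h \sum_r \sum_j
    ginv F p m i * fundamental F p h r *
    (conjC (CFL F r j m p) - conjC (CFL F r m j p)) *
    p.2 0 h * conjC (p.2 0 j).

Definition generalized_Berwald (D : set vec) (F : T -> R) : Prop :=
  forall h i p, slit_tangent D p -> detab h (spray F i) p = 0.

Definition weakly_Kahler (D : set vec) (F : T -> R) : Prop :=
  forall k p, slit_tangent D p ->
    \sum_i \sum_j \sum_l fundamental F p i l *
      (CFL F i j k p - CFL F i k j p) * p.2 0 j * conjC (p.2 0 l) = 0.

Definition complex_Berwald (D : set vec) (F : T -> R) : Prop :=
  generalized_Berwald D F /\ weakly_Kahler D F.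

(* P is smooth on the whole of T'D; the equation is read off the zero section,
   where the spray coefficients are defined. *)
Definition projectively_related (D : set vec) (F F' : T -> R) : Prop :=
  exists2 P : T -> C, csmooth (tangent D) P &
    forall i p, slit_tangent D p ->
      spray F' i p =
        spray F i p + (theta F' i p - theta F i p) / 2%:R + P p * p.2 0 i.

(* F written in the coordinates w = z A + b, xi = eta A on T'C^n. *)
Definition in_chart (A : 'M[C]_n) (b : vec) (F : T -> R) : T -> R :=
  fun p => F ((p.1 - b) *m invmx A, p.2 *m invmx A).

(* The local charts of a domain of C^n are its affine coordinate systems on
   open subsets.  The class has to be fixed relative to the coordinates of C^n
   because G^i = (1/F) (dF/dz^k) eta^k eta^i, an equation in the coordinates z,
   is not preserved by nonlinear holomorphic changes of coordinates (on C^2,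
   the Euclidean metric pulled back by (z1, z2 + z1^2) violates it), whereas
   affine changes preserve it. *)
Definition locally_Minkowski (D : set vec) (F : T -> R) : Prop :=
  forall z0, D z0 ->
    exists (U : set vec) (A : 'M[C]_n) (b : vec),
      [/\ open U, U z0, U `<=` D, A \in unitmx &
          forall z z' xi : vec, U z -> U z' -> xi != 0 ->
            fundamental (in_chart A b F) (z *m A + b, xi) =
            fundamental (in_chart A b F) (z' *m A + b, xi)].

Definition locally_projectively_flat (D : set vec) (F : T -> R) : Prop :=
  exists F' : T -> R, [/\ complex_Finsler D F', locally_Minkowski D F' &
    projectively_related D F F'].

End Finsler.

(* Main.v *)
(* Write L = F^2, Q = F^-1 (dF/dz^k) eta^k and J (z, eta) = (z, i eta).  Euler's
   relations give G^i g_{i m-bar} conj(eta^m) = Q L, while the same contraction of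
   theta* vanishes by antisymmetry.
   If F is projectively related to a locally Minkowski metric, whose connection
   vanishes, then 0 = G^i - theta*^i / 2 + P eta^i; contracting gives P = - Q.  Under
   J the vectors G^i and Q eta^i change sign and theta*^i does not, so theta* = 0 and
   G^i = Q eta^i.  Finally Q = - P is homogeneous of degree 1 and extends smoothly
   across the zero section, so it is C-linear on the fibres and G^i is holomorphic.
   Conversely, if G^i = Q eta^i is holomorphic in eta, then so is Q off the zero
   section, and Q is homogeneous of degree 1.  For independent eta, v the function
   t |-> Q (eta + t v) - t Q v is entire with a finite limit at infinity, hence
   constant by the maximum principle; its values at 0 and 1 show that Q is additive.
   So Q is linear on the fibres and extends smoothly, theta* = 0, and F is
   projectively related to the frozen metric F (z0, eta). *)
Require Import Defs.
From HB Require Import structures.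
From mathcomp Require Import all_boot all_order all_algebra.
From mathcomp Require Import complex.
From mathcomp Require Import all_classical all_reals all_analysis.
From mathcomp Require Import ring lra.

Set Implicit Arguments.
Unset Strict Implicit.
Unset Printing Implicit Defensive.

Import Order.TTheory GRing.Theory Num.Theory.
Import numFieldNormedType.Exports.

Local Open Scope classical_set_scope.
Local Open Scope ring_scope.

(** Only multiplication by i is used on theta*, and for a reason: theta* differentiates [CF], which
    contains the inverse matrix of g, and no regularity of [CF] is established. For the factor i the
    Wirtinger operators merely permute real derivatives and change signs, which agrees with the
    default value 0 of [derive1]; a general factor would call for additivity in the direction, hence
    for C^1. One rotation is enough, since G^i scales by i^2 = -1 and theta* by i conj(i) = 1.
    Smoothness is phrased through iterated derivatives along real lines, so additivity in the
    direction and symmetry of second derivatives have to precede harmonicity and the maximum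
    principle. The limit at infinity is read off Q (eta + t v) - t Q v = t (Q (v + eta / t) - Q v),
    which tends to the derivative of Q at v along eta; independence of eta and v keeps the line eta
    + t v away from the zero section. Q always has complex degree 1; regularity at eta = 0 is what
    forces linearity. In the converse the projective factor must be regular there too, so it is
    assembled from the values Q (z, e_k). *)

(** * Complex numbers through their real and imaginary parts *)

Section ComplexNumbers.
Variable R : realType.
Local Notation C := (Cplx R).
Local Notation Re x := (complex.Re x).
Local Notation Im x := (complex.Im x).
Implicit Types (x y : C) (a b : R).

Lemma CplxP x y : Re x = Re y -> Im x = Im y -> x = y.
Proof. by case: x => ? ?; case: y => ? ? /= -> ->. Qed.

Lemma Re_toC a : Re (toC a) = a. Proof. by []. Qed.
Lemma Im_toC a : Im (toC a) = 0. Proof. by []. Qed.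
Lemma Re_iC : Re (iC R) = 0. Proof. by []. Qed.
Lemma Im_iC : Im (iC R) = 1. Proof. by []. Qed.
Lemma Re0 : Re (0 : C) = 0. Proof. by []. Qed.
Lemma Im0 : Im (0 : C) = 0. Proof. by []. Qed.
Lemma Re1 : Re (1 : C) = 1. Proof. by []. Qed.
Lemma Im1 : Im (1 : C) = 0. Proof. by []. Qed.
Lemma ReD x y : Re (x + y) = Re x + Re y.
Proof. by case: x; case: y. Qed.
Lemma ImD x y : Im (x + y) = Im x + Im y.
Proof. by case: x; case: y. Qed.
Lemma ReN x : Re (- x) = - Re x.
Proof. by case: x. Qed.
Lemma ImN x : Im (- x) = - Im x.
Proof. by case: x. Qed.
Lemma ReM x y : Re (x * y) = Re x * Re y - Im x * Im y.
Proof. by case: x; case: y. Qed.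
Lemma ImM x y : Im (x * y) = Re x * Im y + Im x * Re y.
Proof. by case: x; case: y. Qed.
Lemma Re_conjC x : Re (conjC x) = Re x.
Proof. by case: x. Qed.
Lemma Im_conjC x : Im (conjC x) = - Im x.
Proof. by case: x. Qed.

Local Opaque toC conjC iC.

(** Together with [CplxP] this splits an equation over C into two polynomial identities over R,
    within reach of [ring], [field] and [lra]. *)
Definition ReImE := (ReD, ImD, ReN, ImN, ReM, ImM, Re_conjC, Im_conjC,
  Re_toC, Im_toC, Re_iC, Im_iC, Re0, Im0, Re1, Im1).

Lemma CplxE x : x = toC (Re x) + iC R * toC (Im x).
Proof. by apply: CplxP; rewrite !ReImE; ring. Qed.

Lemma iCiC : iC R * iC R = -1.
Proof. by apply: CplxP; rewrite !ReImE; ring. Qed.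

Lemma toCD a b : toC (a + b) = toC a + toC b.
Proof. by apply: CplxP; rewrite !ReImE; ring. Qed.
Lemma toCM a b : toC (a * b) = toC a * toC b.
Proof. by apply: CplxP; rewrite !ReImE; ring. Qed.
Lemma toCN a : toC (- a) = - toC a.
Proof. by apply: CplxP; rewrite !ReImE; ring. Qed.
Lemma toC0 : toC 0 = 0 :> C. Proof. by apply: CplxP; rewrite !ReImE. Qed.
Lemma toC1 : toC 1 = 1 :> C. Proof. by apply: CplxP; rewrite !ReImE. Qed.
Lemma toC_eq0 a : (toC a == 0 :> C) = (a == 0).
Proof. by apply/eqP/eqP => [/(congr1 (fun z : C => Re z))|->]. Qed.
Lemma toCV a : toC a^-1 = (toC a)^-1 :> C.
Proof.
have [->|a0] := eqVneq a 0; first by rewrite toC0 !invr0 toC0.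
apply: (@mulfI _ (toC a)); first by rewrite toC_eq0.
by rewrite -toCM !divff ?toC_eq0.
Qed.
Lemma conjCD x y : conjC (x + y) = conjC x + conjC y.
Proof. by apply: CplxP; rewrite !ReImE; ring. Qed.
Lemma conjCN x : conjC (- x) = - conjC x.
Proof. by apply: CplxP; rewrite !ReImE; ring. Qed.
Lemma conjCM x y : conjC (x * y) = conjC x * conjC y.
Proof. by apply: CplxP; rewrite !ReImE; ring. Qed.
Lemma conjCK x : conjC (conjC x) = x.
Proof. by apply: CplxP; rewrite !ReImE; ring. Qed.
Lemma conjC0 : conjC (0 : C) = 0.
Proof. by apply: CplxP; rewrite !ReImE; ring. Qed.
Lemma conjC1 : conjC (1 : C) = 1.
Proof. by apply: CplxP; rewrite !ReImE; ring. Qed.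
Lemma conjC_toC a : conjC (toC a) = toC a.
Proof. by apply: CplxP; rewrite !ReImE; ring. Qed.
Lemma conjC_iC : conjC (iC R) = - iC R.
Proof. by apply: CplxP; rewrite !ReImE; ring. Qed.
Lemma conjC_sum (I : Type) (r : seq I) (f : I -> C) :
  conjC (\sum_(i <- r) f i) = \sum_(i <- r) conjC (f i).
Proof. by apply: (big_morph _ conjCD conjC0). Qed.

Local Transparent toC conjC iC.

Lemma norm_toC a : `|toC a| = toC `|a|.
Proof.
by rewrite /toC [LHS]normc_def /= expr0n /= addr0 sqrtr_sqr.
Qed.
Lemma norm_iC : `|iC R| = 1.
Proof.
by rewrite /iC [LHS]normc_def /= expr0n /= add0r expr1n sqrtr1.
Qed.
Lemma iC_neq0 : iC R != 0.
Proof. by rewrite -normr_eq0 norm_iC oner_eq0. Qed.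

Lemma norm_conjC x : `|x| ^+ 2 = x * conjC x.
Proof. exact: (sqr_normc (x : R[i])). Qed.

Lemma ltc_toC a b : (toC a < toC b :> C) = (a < b).
Proof. exact: ltcR. Qed.
Lemma lec_toC a b : (toC a <= toC b :> C) = (a <= b).
Proof. exact: lecR. Qed.

(** Radii of balls in C are positive elements of C; this makes them real numbers. It also shows that
    the diagonal values of a positive definite form are real. *)
Lemma gt0_toC x : 0 < x -> x = toC (Re x).
Proof. by case: x => a b; rewrite ltcE /= => /andP[/eqP -> _]. Qed.

Local Opaque toC conjC iC.

Lemma norm_Re x : toC `|Re x| <= `|x|.
Proof. exact: normc_ge_Re. Qed.
Lemma norm_Im x : toC `|Im x| <= `|x|.
Proof.
have -> : `|x| = `|iC R * x| by rewrite normrM norm_iC mul1r.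
apply: le_trans (norm_Re _).
by rewrite !ReImE lec_toC mul0r mul1r sub0r normrN.
Qed.

End ComplexNumbers.

Section Continuity.
Variable R : realType.
Local Notation C := (Cplx R).

Lemma continuous_toC : continuous (@toC R).
Proof.
move=> a; apply/cvgrPdist_lt => e e0.
have ee := gt0_toC e0; rewrite ee -toC0 ltc_toC in e0.
near=> t; rewrite -toCN -toCD norm_toC ee ltc_toC.
by near: t; exact: cvgr_dist_lt.
Unshelve. all: by end_near. Qed.

Lemma continuous_Re : continuous (fun x : C => complex.Re x).
Proof.
move=> x; have FF : Filter (nbhs (x : C)) := nbhs_filter (x : C).
apply/(@cvgrPdist_lt _ _ _ (nbhs (x : C))) => e e0.
have e0' : 0 < toC e by rewrite -toC0 ltc_toC.
have := @cvg_id _ (nbhs (x : C)); move=> /cvgrPdist_lt /(_ _ e0').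
apply: filterS => t xt; rewrite -ReN -ReD -ltc_toC.
exact: le_lt_trans (norm_Re _) xt.
Qed.

Lemma continuous_Im : continuous (fun x : C => complex.Im x).
Proof.
move=> x; have FF : Filter (nbhs (x : C)) := nbhs_filter (x : C).
apply/(@cvgrPdist_lt _ _ _ (nbhs (x : C))) => e e0.
have e0' : 0 < toC e by rewrite -toC0 ltc_toC.
have := @cvg_id _ (nbhs (x : C)); move=> /cvgrPdist_lt /(_ _ e0').
apply: filterS => t xt; rewrite -ImN -ImD -ltc_toC.
exact: le_lt_trans (norm_Im _) xt.
Qed.

End Continuity.

(** * Directional derivatives along real lines *)

Section RealDerivative.
Variables (R : realType) (n : nat).
Local Notation C := (Cplx R).
Local Notation vec := ('rV[Cplx R]_n).
Local Notation T := ('rV[Cplx R]_n * 'rV[Cplx R]_n)%type.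
Implicit Types (f g : T -> R) (p v w : T) (O : set T).

Lemma continuous_plane (p v w : T) :
  continuous (fun t : R * R => p + toC t.1 *: v + toC t.2 *: w).
Proof.
move=> t; apply: cvgD; first apply: cvgD.
- exact: cvg_cst.
- apply: cvgZr_tmp; apply: (@continuous_comp _ _ _ fst (@toC R)).
    exact: cvg_fst.
  exact: continuous_toC.
- apply: cvgZr_tmp; apply: (@continuous_comp _ _ _ snd (@toC R)).
    exact: cvg_snd.
  exact: continuous_toC.
Qed.

Lemma continuous_line (p v : T) : continuous (fun t : R => p + toC t *: v).
Proof.
move=> t; apply: cvgD; first exact: cvg_cst.
by apply: cvgZr_tmp; exact: continuous_toC.
Qed.

Lemma near_line O p v : open O -> O p -> \forall t \near (0 : R), O (p + toC t *: v).
Proof.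
move=> oO Op; have := @continuous_line p v 0; rewrite /continuous_at toC0 scale0r addr0.
by apply; exact: open_nbhs_nbhs.
Qed.

(** The difference quotients are the same function, so the values of [derive1] agree whether or not
    a derivative exists. *)
Lemma derive_reparam (g h : R -> R) a b : (forall s, g (a + s) = h (b + s)) ->
  (derivable g a 1 -> derivable h b 1) /\ derive1 g a = derive1 h b.
Proof.
move=> gh; rewrite !derive1E /derivable /derive.
suff -> : (fun t => t^-1 *: (g (t *: 1 + a) - g a)) =
  (fun t => t^-1 *: (h (t *: 1 + b) - h b)) by [].
by apply/funext => t; rewrite [_ + a]addrC [_ + b]addrC gh -[in g a](addr0 a) gh addr0.
Qed.

Lemma real_line_shift f p v (t s : R) :
  real_line f p v (t + s) = real_line f (p + toC t *: v) v (0 + s).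
Proof. by rewrite /real_line add0r toCD scalerDl addrA. Qed.

Lemma is_derive_line f p v (t : R) : rderivable f (p + toC t *: v) v ->
  is_derive t 1 (real_line f p v) (rderive f v (p + toC t *: v)).
Proof.
move=> df.
have [_ e] := derive_reparam (real_line_shift f p v t).
have [d _] := derive_reparam (fun s => esym (real_line_shift f p v t s)).
exact: (DeriveDef (d df) (etrans (esym (derive1E _ _)) e)).
Qed.

Lemma rderivable_is_derive f p v : rderivable f p v ->
  is_derive (0 : R) 1 (real_line f p v) (rderive f v p).
Proof. by move=> df; exact: (DeriveDef df (esym (derive1E _ _))). Qed.

Lemma is_derive_rderive f p v (d : R) :
  is_derive (0 : R) 1 (real_line f p v) d -> rderivable f p v /\ rderive f v p = d.
Proof.
move=> h; split; first exact: (@ex_derive _ _ _ _ _ _ _ h).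
exact: (etrans (derive1E _ _) (@derive_val _ _ _ _ _ _ _ h)).
Qed.

Lemma near_eq_rderive O f g p v : open O -> O p -> (forall q, O q -> f q = g q) ->
  (rderivable f p v -> rderivable g p v) /\ rderive f v p = rderive g v p.
Proof.
move=> oO Op fg.
have h : {near (0 : R), real_line f p v =1 real_line g p v}.
  by near=> t; apply: fg; near: t; exact: near_line.
split; first exact: near_eq_derivable.
by rewrite /rderive !derive1E; exact: near_eq_derive.
Unshelve. all: by end_near. Qed.

Lemma rderiveD f g p v : rderivable f p v -> rderivable g p v ->
  rderivable (fun q => f q + g q) p v /\
  rderive (fun q => f q + g q) v p = rderive f v p + rderive g v p.
Proof.
move=> /rderivable_is_derive df /rderivable_is_derive dg.
by apply: is_derive_rderive; exact: is_deriveD.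
Qed.

Lemma rderiveM f g p v : rderivable f p v -> rderivable g p v ->
  rderivable (fun q => f q * g q) p v /\
  rderive (fun q => f q * g q) v p = f p * rderive g v p + g p * rderive f v p.
Proof.
move=> /rderivable_is_derive df /rderivable_is_derive dg.
apply: is_derive_rderive.
rewrite (_ : p = p + toC 0 *: v) ; last by rewrite toC0 scale0r addr0.
have := is_deriveM df dg.
by rewrite /real_line /= toC0 scale0r !addr0.
Qed.

Lemma rderiveV f p v : rderivable f p v -> f p != 0 ->
  rderivable (fun q => (f q)^-1) p v /\
  rderive (fun q => (f q)^-1) v p = - ((f p)^-1 * (f p)^-1 * rderive f v p).
Proof.
move=> df fp.
have fp' : real_line f p v 0 != 0 by rewrite /real_line toC0 scale0r addr0.
split; first exact: derivableV.
rewrite /rderive derive1E [LHS](deriveV fp' df) -derive1E.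
by rewrite {1}/real_line toC0 scale0r addr0 expr2 invfM scaleNr.
Qed.

Lemma rderive_cst (c : R) p v : rderivable (fun=> c) p v /\ rderive (fun=> c) v p = 0.
Proof. by apply: is_derive_rderive; exact: is_derive_cst. Qed.

(* The limit of a divergent filter is [point], which is [0] in [R]. *)
Lemma derive1_junk (g : R -> R) a : ~ derivable g a 1 -> derive1 g a = 0.
Proof. by move=> nd; rewrite derive1E /derive (dvgP nd); reflexivity. Qed.

Lemma derive1_opp_junk (g : R -> R) a : derive1 (fun t => - g t) a = - derive1 g a.
Proof.
have [dg|ndg] := pselect (derivable g a 1).
  by rewrite !derive1E; exact: deriveN.
rewrite (derive1_junk ndg) oppr0; apply: derive1_junk => dNg; apply: ndg.
rewrite (_ : g = - (fun t => - g t)); first exact: derivableN.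
by apply/funext => t; rewrite fctE opprK.
Qed.

Lemma is_derive_comp_opp (g : R -> R) (d : R) :
  is_derive (0 : R) 1 g d -> is_derive (0 : R) 1 (fun t => g (- t)) (- d).
Proof.
move=> dg; rewrite -mulrN1; apply: (@is_derive1_comp _ g -%R).
by rewrite oppr0.
Qed.

Lemma derive1_comp_opp_junk (g : R -> R) : derive1 (fun t => g (- t)) 0 = - derive1 g 0.
Proof.
have dN (h : R -> R) : derivable h 0 1 -> derivable (fun t => h (- t)) 0 1.
  move=> dh.
  exact: (@ex_derive _ _ _ _ _ _ _ (is_derive_comp_opp (DeriveDef dh erefl))).
have [dg|ndg] := pselect (derivable g 0 1).
  rewrite !derive1E.
  exact: (@derive_val _ _ _ _ _ _ _ (is_derive_comp_opp (DeriveDef dg erefl))).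
rewrite (derive1_junk ndg) oppr0; apply: derive1_junk => /dN dNg; apply: ndg.
rewrite (_ : g = (fun t => g (- - t))); first exact: dNg.
by apply/funext => t /=; rewrite opprK.
Qed.

(** This sign rule and the next hold for arbitrary [f], because the default value 0 is its own
    opposite; they are what can be applied to the connection coefficients. *)
Lemma rderiveN_junk f p v : rderive (fun q => - f q) v p = - rderive f v p.
Proof. exact: derive1_opp_junk. Qed.

Lemma rderive_oppv_junk f p v : rderive f (- v) p = - rderive f v p.
Proof.
rewrite /rderive -derive1_comp_opp_junk; congr (derive1 _ 0).
by apply/funext => t; rewrite /real_line toCN scaleNr scalerN.
Qed.

Lemma rderiveZv f p v (c : R) : rderivable f p v ->
  rderivable f p (toC c *: v) /\ rderive f (toC c *: v) p = c * rderive f v p.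
Proof.
move=> df; apply: is_derive_rderive.
have -> : real_line f p (toC c *: v) = real_line f p v \o ( *:%R c : R -> R).
  by apply/funext => t; rewrite /real_line /= scalerA -toCM mulrC.
have d1 : is_derive (0 : R) 1 ( *:%R c : R -> R) c.
  by apply: is_derive_eq; rewrite /GRing.scale /= mulr1.
have d2 : is_derive (c *: (0 : R)) 1 (real_line f p v) (rderive f v p).
  by rewrite scaler0; exact: rderivable_is_derive.
have := @is_derive1_comp _ _ _ _ _ _ d2 d1.
by rewrite mulrC.
Qed.

End RealDerivative.

Local Opaque toC conjC iC.

(** * Functions of class C^k *)

Section DifferentiabilityClasses.
Variables (R : realType) (n : nat).
Local Notation C := (Cplx R).
Local Notation vec := ('rV[Cplx R]_n).
Local Notation T := ('rV[Cplx R]_n * 'rV[Cplx R]_n)%type.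
Implicit Types (f g : T -> R) (p v w : T) (O : set T).

Lemma Ck_continuous k O f p : Ck k O f -> O p -> {for p, continuous f}.
Proof. by case: k => [|k] [cf _]; exact: cf. Qed.

Lemma Ck_rderivable k O f p v : Ck k.+1 O f -> O p -> rderivable f p v.
Proof. by move=> [_ /(_ v)[df _]]; exact: df. Qed.

Lemma Ck_rderive k O f v : Ck k.+1 O f -> Ck k O (rderive f v).
Proof. by move=> [_ /(_ v)[_ df]]. Qed.

Lemma CkS k O f : Ck k.+1 O f -> Ck k O f.
Proof.
elim: k f => [|k ih] f [cf df]; split => // v.
split; first exact: (df v).1.
by apply: ih; exact: (df v).2.
Qed.

Lemma near_eq_continuous O f g p : open O -> O p -> (forall q, O q -> f q = g q) ->
  {for p, continuous f} -> {for p, continuous g}.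
Proof.
move=> oO Op fg cf; change (g @ p --> g p); rewrite -(fg p Op).
apply: cvg_trans cf; apply: near_eq_cvg.
have nO : \forall q \near p, O q by exact: open_nbhs_nbhs.
by apply: filterS nO => q Oq; exact: fg.
Qed.

Lemma eq_Ck k O f g : open O -> (forall q, O q -> f q = g q) -> Ck k O f -> Ck k O g.
Proof.
move=> oO; elim: k f g => [|k ih] f g fg [cf df]; split.
- by move=> p Op; exact: near_eq_continuous fg (cf p Op).
- by [].
- by move=> p Op; exact: near_eq_continuous fg (cf p Op).
move=> v; split.
  by move=> p Op; apply: (near_eq_rderive v oO Op fg).1; exact: (df v).1.
apply: ih (df v).2 => q Oq; exact: (near_eq_rderive v oO Oq fg).2.
Qed.

Lemma Ck_cst k O (c : R) : open O -> Ck k O (fun=> c).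
Proof.
move=> oO; elim: k c => [|k ih] c; split => //.
- by move=> p _; exact: cvg_cst.
- by move=> p _; exact: cvg_cst.
move=> v; split; first by move=> p _; exact: (rderive_cst c p v).1.
apply: eq_Ck (ih 0) => // q _; exact/esym/(rderive_cst c q v).2.
Qed.

Lemma CkD k O f g : open O -> Ck k O f -> Ck k O g -> Ck k O (fun q => f q + g q).
Proof.
move=> oO; elim: k f g => [|k ih] f g [cf df] [cg dg]; split => //.
- by move=> p Op; apply: cvgD; [exact: cf|exact: cg].
- by move=> p Op; apply: cvgD; [exact: cf|exact: cg].
move=> v; have h p (Op : O p) := rderiveD ((df v).1 p Op) ((dg v).1 p Op).
split; first by move=> p Op; exact: (h p Op).1.
by apply: eq_Ck (ih _ _ (df v).2 (dg v).2) => // q Oq; exact/esym/(h q Oq).2.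
Qed.

Lemma CkM k O f g : open O -> Ck k O f -> Ck k O g -> Ck k O (fun q => f q * g q).
Proof.
move=> oO; elim: k f g => [|k ih] f g fk gk.
  move: fk gk => [cf df] [cg dg]; split => // p Op.
  by apply: cvgM; [exact: cf|exact: cg].
have [fk' gk'] := (CkS fk, CkS gk); move: fk gk => [cf df] [cg dg]; split.
  by move=> p Op; apply: cvgM; [exact: cf|exact: cg].
move=> v; have h p (Op : O p) := rderiveM ((df v).1 p Op) ((dg v).1 p Op).
split; first by move=> p Op; exact: (h p Op).1.
apply: eq_Ck (CkD oO (ih _ _ fk' (dg v).2) (ih _ _ gk' (df v).2)) => // q Oq.
exact/esym/(h q Oq).2.
Qed.

Lemma CkN k O f : open O -> Ck k O f -> Ck k O (fun q => - f q).
Proof.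
move=> oO fk; apply: eq_Ck (CkM oO (Ck_cst k (-1) oO) fk) => // q _.
by rewrite mulN1r.
Qed.

Lemma CkV k O f : open O -> (forall p, O p -> f p != 0) -> Ck k O f ->
  Ck k O (fun q => (f q)^-1).
Proof.
move=> oO f0; elim: k => [|k ih] fk.
  by move: fk => [cf df]; split => // p Op; apply: cvgV; [exact: f0|exact: cf].
have fk' := ih (CkS fk); move: fk => [cf df]; split.
  by move=> p Op; apply: cvgV; [exact: f0|exact: cf].
move=> v; have h p (Op : O p) := rderiveV ((df v).1 p Op) (f0 p Op).
split; first by move=> p Op; exact: (h p Op).1.
apply: eq_Ck (CkN oO (CkM oO (CkM oO fk' fk') (df v).2)) => // q Oq.
exact/esym/(h q Oq).2.
Qed.

(** [phi0] is the linear part of the affine map [phi]. The chain rule is here an equality of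
    functions of t, before any limit is taken. *)
Lemma rderive_comp_affine f (phi phi0 : T -> T) p v :
  (forall p v (t : R), phi (p + toC t *: v) = phi p + toC t *: phi0 v) ->
  real_line (fun q => f (phi q)) p v = real_line f (phi p) (phi0 v).
Proof. by move=> aff; apply/funext => t; rewrite /real_line aff. Qed.

Lemma Ck_comp_affine k O O' f (phi phi0 : T -> T) :
  (forall p v (t : R), phi (p + toC t *: v) = phi p + toC t *: phi0 v) ->
  continuous phi -> (forall p, O' p -> O (phi p)) ->
  Ck k O f -> Ck k O' (fun q => f (phi q)).
Proof.
move=> aff cphi OO; elim: k f => [|k ih] f [cf df]; split => //.
- move=> p Op; apply: (@continuous_comp _ _ _ phi f); first exact: cphi.
  by apply: cf; exact: OO.
- move=> p Op; apply: (@continuous_comp _ _ _ phi f); first exact: cphi.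
  by apply: cf; exact: OO.
move=> v; split.
  move=> p Op; rewrite /rderivable (rderive_comp_affine _ _ _ aff).
  by apply: (df (phi0 v)).1; exact: OO.
have -> : rderive (fun q => f (phi q)) v = fun q => rderive f (phi0 v) (phi q).
  by apply/funext => q; rewrite /rderive (rderive_comp_affine _ _ _ aff).
by apply: ih; exact: (df (phi0 v)).2.
Qed.

Lemma Ck_linear k O (l : T -> R) : open O -> continuous l ->
  (forall p v (t : R), l (p + toC t *: v) = l p + t * l v) -> Ck k O l.
Proof.
move=> oO cl lin.
have h p v : rderivable l p v /\ rderive l v p = l v.
  apply: is_derive_rderive.
  have -> : real_line l p v = (fun=> l p) + l v *: (id : R -> R).
    by apply/funext => t; rewrite /real_line lin fctE /= mulrC.
  have h := is_deriveD (is_derive_cst (l p : R) (0 : R) (1 : R))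
    (is_deriveZ (l v) (is_derive_id (0 : R) (1 : R))).
  by rewrite add0r [X in is_derive _ _ _ X](mulr1 (l v)) in h.
case: k => [|k]; split; try by move=> p _; exact: cl.
  by [].
move=> v; split; first by move=> p _; exact: (h p v).1.
apply: eq_Ck (Ck_cst k (l v) oO) => // q _; exact/esym/(h q v).2.
Qed.

(** Bounding [s] by the absolute value of [a] covers both signs of the increment at once. *)
Lemma line_MVT f p v (a : R) :
  (forall s : R, `|s| <= `|a| -> rderivable f (p + toC s *: v) v) ->
  exists2 s : R, `|s| <= `|a| &
    f (p + toC a *: v) - f p = a * rderive f v (p + toC s *: v).
Proof.
move=> df.
have der (s : R) : `|s| <= `|a| -> is_derive s 1 (real_line f p v) (rderive f v (p + toC s *: v)).
  by move=> sa; apply: is_derive_line; exact: df.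
have cont (x y : R) : (forall s : R, s \in `[x, y] -> `|s| <= `|a|) ->
    {within `[x, y], continuous (real_line f p v)}.
  move=> xy; apply: derivable_within_continuous => s /xy sa.
  exact: (@ex_derive _ _ _ _ _ _ _ (der s sa)).
have f0 : real_line f p v 0 = f p by rewrite /real_line toC0 scale0r addr0.
have [a0|a0] := leP 0 a.
  have ia (s : R) : s \in `[0, a] -> `|s| <= `|a|.
    by rewrite in_itv /= => /andP[s0 sa]; rewrite !ger0_norm.
  have der0 s : s \in `]0, a[ -> is_derive s 1 (real_line f p v) (rderive f v (p + toC s *: v)).
    by move=> s0a; apply: der; apply: ia; exact: subset_itv_oo_cc.
  have [s s0a e] := MVT_segment a0 der0 (cont _ _ ia).
  by exists s; [exact: ia | rewrite -f0 -/(real_line f p v a) e subr0 mulrC].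
have ia (s : R) : s \in `[a, 0] -> `|s| <= `|a|.
  by rewrite in_itv /= => /andP[s0 sa]; rewrite !ler0_norm ?lerN2 // ltW.
have der0 s : s \in `]a, 0[ -> is_derive s 1 (real_line f p v) (rderive f v (p + toC s *: v)).
  by move=> s0a; apply: der; apply: ia; exact: subset_itv_oo_cc.
have [s s0a e] := MVT_segment (ltW a0) der0 (cont _ _ ia).
exists s; first exact: ia.
by apply: oppr_inj; rewrite -f0 -/(real_line f p v a) opprB e sub0r mulrN mulrC.
Qed.

Lemma near_plane (P : T -> Prop) p v w : (\forall q \near p, P q) ->
  exists2 d : R, 0 < d & forall a b : R, `|a| < d -> `|b| < d ->
    P (p + toC a *: v + toC b *: w).
Proof.
move=> Pp; have := @continuous_plane R n p v w (0, 0).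
rewrite /continuous_at /= toC0 !scale0r !addr0 => /(_ P Pp) /nbhs_ballP[d /= d0 h].
exists d => // a b ad bd; apply: (h (a, b)); split; rewrite /ball /= sub0r normrN //.
Qed.

(** First-order expansion on a real plane: the increment is split into one leg along [w] and one
    along [v], the mean value theorem is applied to each, and continuity of the two derivatives
    bounds the error. It serves both for additivity in the direction and for the limit at infinity
    in the fibre. *)
Lemma C1_plane O f p v w (e : R) : open O -> Ck 1 O f -> O p -> 0 < e ->
  exists2 d : R, 0 < d & forall a b : R, `|a| < d -> `|b| < d ->
    `|f (p + toC a *: v + toC b *: w) - f p - (a * rderive f v p + b * rderive f w p)|
      <= e * (`|a| + `|b|).
Proof.
move=> oO f1 Op e0.
have near_small u : \forall q \near p, `|rderive f u p - rderive f u q| < e.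
  by have /cvgrPdist_lt := Ck_continuous (Ck_rderive u f1) Op; apply.
have Onear : \forall q \near p, O q by exact: open_nbhs_nbhs.
have [d d0 h] := near_plane v w (filterI Onear (filterI (near_small v) (near_small w))).
exists d => // a b ad bd.
have [|s sa es] := @line_MVT f (p + toC b *: w) v a.
  move=> s sa; apply: (@Ck_rderivable 0 O f _ _ f1).
  rewrite addrAC; apply: (h s b _ bd).1; exact: le_lt_trans sa ad.
have [|t tb et] := @line_MVT f p w b.
  move=> u ub; apply: (@Ck_rderivable 0 O f _ _ f1).
  have := (h 0 u _ (le_lt_trans ub bd)).1; rewrite toC0 scale0r addr0; apply.
  by rewrite normr0.
have hs := (h s b (le_lt_trans sa ad) bd).2.1.
have ht := (h 0 t _ (le_lt_trans tb bd)).2.2.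
rewrite toC0 scale0r addr0 normr0 in ht; have {}ht := ht d0.
rewrite (addrAC p) in hs; rewrite (addrAC p).
have -> : f (p + toC b *: w + toC a *: v) - f p = a * rderive f v (p + toC b *: w + toC s *: v)
   + b * rderive f w (p + toC t *: w) by rewrite -es -et; ring.
move: hs ht; set X := rderive f v (_ + _); set Y := rderive f w (_ + _).
move: X Y (rderive f v p) (rderive f w p) => X Y X0 Y0 hs ht.
rewrite [X in `|X|](_ : _ = - (a * (X0 - X) + b * (Y0 - Y))); last by ring.
rewrite normrN; apply: le_trans (ler_normD _ _) _; rewrite !normrM mulrDr.
by apply: lerD; rewrite mulrC; apply: ler_wpM2r; (exact: normr_ge0 || exact: ltW).
Qed.

Lemma rderive_addv O f p v w : open O -> Ck 1 O f -> O p ->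
  rderive f (v + w) p = rderive f v p + rderive f w p.
Proof.
move=> oO f1 Op.
suff : is_derive (0 : R) 1 (real_line f p (v + w)) (rderive f v p + rderive f w p).
  by move=> /is_derive_rderive[].
have h : (fun h : R => h^-1 *: (real_line f p (v + w) (h *: 1 + 0) - real_line f p (v + w) 0))
  @ 0^' --> (rderive f v p + rderive f w p : R).
  apply/cvgrPdist_le => /= e e0.
  (* Both increments will be t, so the error is e / 2 times 2 |t|. *)
  have e20 : 0 < e / 2 by rewrite divr_gt0.
  have [d d0 hd] := C1_plane v w oO f1 Op e20.
  near=> t.
  have t0 : t != 0 by near: t; exact: nbhs_dnbhs_neq.
  have td : `|t| < d.
    near: t; apply: nbhs_dnbhs; near=> t.
    rewrite -[t]subr0 distrC; near: t; exact: cvgr_dist_lt.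
  have := hd t t td td.
  rewrite /real_line /= [t *: _]mulr1 addr0 toC0 scale0r addr0.
  rewrite (scalerDr _ v) addrA.
  set A := f _; set B := f p; set X := rderive f v p; set Y := rderive f w p => hA.
  have -> : X + Y - t^-1 *: (A - B) = - (t^-1 * (A - B - (t * X + t * Y))).
    by rewrite /GRing.scale /=; field.
  rewrite normrN normrM normfV ler_pdivrMl ?normr_gt0 //.
  by apply: le_trans hA _; rewrite mulrC -mulr2n -mulr_natl; lra.
apply: DeriveDef; first by apply/cvg_ex; eexists; exact: h.
exact: (cvg_lim _ h).
Unshelve. all: by end_near. Qed.

(** The second difference of [f] over the parallelogram with sides h v and h w is symmetric in [v]
    and [w]. Two mean values express it as h^2 times a mixed derivative at a nearby point, in either
    order; continuity of both mixed derivatives concludes. *)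
Lemma Clairaut O f p v w : open O -> Ck 2 O f -> O p ->
  rderive (rderive f v) w p = rderive (rderive f w) v p.
Proof.
move=> oO f2 Op; apply/eqP; rewrite -subr_eq0 -normr_le0; apply/ler_addgt0Pr => e e0.
have e20 : 0 < e / 2 by rewrite divr_gt0.
have near_small u u' : \forall q \near p,
    `|rderive (rderive f u) u' p - rderive (rderive f u) u' q| < e / 2.
  by have /cvgrPdist_lt := Ck_continuous (Ck_rderive u' (Ck_rderive u f2)) Op; apply.
have Onear : \forall q \near p, O q by exact: open_nbhs_nbhs.
have [d d0 hd] := near_plane v w (filterI Onear (filterI (near_small v w) (near_small w v))).
(* The corner values are variables so that the instance with [v] and [w] exchanged can use the same
   expression for the far corner. *)
have key v' w' (h x y z : R) : x = f (p + toC h *: v' + toC h *: w') ->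
    y = f (p + toC h *: w') -> z = f (p + toC h *: v') ->
    (forall a b : R, `|a| <= `|h| -> `|b| <= `|h| -> O (p + toC a *: v' + toC b *: w')) ->
    exists s t : R, [/\ `|s| <= `|h|, `|t| <= `|h| &
      x - y - (z - f p) =
      h * (h * rderive (rderive f v') w' (p + toC s *: v' + toC t *: w'))].
  move=> -> -> -> hO.
  have aff q u t : q + toC t *: u + toC h *: w' = q + toC h *: w' + toC t *: u.
    by rewrite addrAC.
  pose g q := f (q + toC h *: w') - f q.
  have gE (s : R) : `|s| <= `|h| ->
      rderivable g (p + toC s *: v') v' /\ rderive g v' (p + toC s *: v') =
      rderive f v' (p + toC s *: v' + toC h *: w') - rderive f v' (p + toC s *: v').
    move=> sh; apply: is_derive_rderive; apply: is_deriveB.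
      have -> : (fun t : R => f (p + toC s *: v' + toC t *: v' + toC h *: w')) =
        real_line f (p + toC s *: v' + toC h *: w') v'.
        by apply/funext => t; rewrite /real_line; congr f; exact: aff.
      apply: rderivable_is_derive; apply: (@Ck_rderivable 1 O f _ _ f2).
      exact: hO.
    apply: rderivable_is_derive; apply: (@Ck_rderivable 1 O f _ _ f2).
    have := hO s 0 sh; rewrite toC0 scale0r addr0; apply.
    by rewrite normr0 normr_ge0.
  have [s sh|s sh es] := @line_MVT g p v' h; first exact: (gE s sh).1.
  have [t th|t th et] := @line_MVT (rderive f v') (p + toC s *: v') w' h.
    by apply: (@Ck_rderivable 0 O _ _ _ (Ck_rderive v' f2)); exact: hO.
  exists s, t; split => //.
  rewrite -et -(gE s sh).2 -es /g; ring.
pose h := d / 2.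
have h0 : 0 < h by rewrite divr_gt0.
have hd' (a : R) : `|a| <= `|h| -> `|a| < d.
  by rewrite (gtr0_norm h0) => /le_lt_trans; apply; rewrite /h; lra.
have [|s1 [t1 [sh1 th1 e1]]] := key v w h _ _ _ erefl erefl erefl.
  by move=> a b /hd' ad /hd' bd; exact: (hd a b ad bd).1.
have [|s2 [t2 [sh2 th2 e2]]] :=
    key w v h _ _ _ (congr1 f (addrAC p (toC h *: v) (toC h *: w))) erefl erefl.
  by move=> a b /hd' ad /hd' bd; rewrite (addrAC p); exact: (hd b a bd ad).1.
have h1 := (hd s1 t1 (hd' _ sh1) (hd' _ th1)).2.1.
have h2 := (hd t2 s2 (hd' _ th2) (hd' _ sh2)).2.2.
rewrite (addrAC p) in h2.
move: h1 h2 e1 e2.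
set A := rderive _ w p; set B := rderive _ v p.
set X := rderive _ w (_ + _); set Y := rderive _ v (_ + _) => h1 h2 e1 e2.
have XY : X = Y.
  apply: (mulfI (lt0r_neq0 h0)); apply: (mulfI (lt0r_neq0 h0)).
  apply: etrans (esym e1) (etrans _ e2); ring.
rewrite -XY in h2; rewrite add0r.
have -> : A - B = (A - X) - (B - X) by ring.
apply: le_trans (ler_normB _ _) _; rewrite (splitr e).
by apply: lerD; apply: ltW; [exact: h1|exact: h2].
Qed.

End DifferentiabilityClasses.

(** * Wirtinger calculus *)

(* [ring] identifies its atoms up to conversion, which blows up on iterated
   derivatives. *)
Ltac atomize :=
  repeat match goal with
  | |- context [cderive ?f ?v ?p] => generalize (cderive f v p); intro
  | |- context [rderive ?f ?v ?p] => generalize (rderive f v p); intro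
  end.

Section SmoothFunctions.
Variables (R : realType) (n : nat).
Local Notation C := (Cplx R).
Local Notation vec := ('rV[Cplx R]_n).
Local Notation T := ('rV[Cplx R]_n * 'rV[Cplx R]_n)%type.
Local Notation Re x := (complex.Re x).
Local Notation Im x := (complex.Im x).
Variables (O : set T) (oO : open O).
Implicit Types (f g : T -> C) (p v w : T).

Lemma eq_csmooth f g : (forall q, O q -> f q = g q) -> csmooth O f -> csmooth O g.
Proof.
move=> fg [rf mf]; split=> k.
  by apply: eq_Ck (rf k) => // q Oq; rewrite fg.
by apply: eq_Ck (mf k) => // q Oq; rewrite fg.
Qed.

Lemma csmooth_toC (f : T -> R) : smooth O f -> csmooth O (fun q => toC (f q)).
Proof.
move=> sf; split=> k; first by apply: eq_Ck (sf k) => // q _; rewrite Re_toC.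
by apply: eq_Ck (Ck_cst k 0 oO) => // q _; rewrite Im_toC.
Qed.

Lemma csmooth_cst (c : C) : csmooth O (fun=> c).
Proof. by split=> k; exact: Ck_cst. Qed.

Lemma csmoothD f g : csmooth O f -> csmooth O g -> csmooth O (fun q => f q + g q).
Proof.
move=> [rf mf] [rg mg]; split=> k.
  by apply: eq_Ck (CkD oO (rf k) (rg k)) => // q _; rewrite ReD.
by apply: eq_Ck (CkD oO (mf k) (mg k)) => // q _; rewrite ImD.
Qed.

Lemma csmoothM f g : csmooth O f -> csmooth O g -> csmooth O (fun q => f q * g q).
Proof.
move=> [rf mf] [rg mg]; split=> k.
  apply: eq_Ck (CkD oO (CkM oO (rf k) (rg k)) (CkN oO (CkM oO (mf k) (mg k)))) => // q _.
  by rewrite ReM.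
apply: eq_Ck (CkD oO (CkM oO (rf k) (mg k)) (CkM oO (mf k) (rg k))) => // q _.
by rewrite ImM.
Qed.

Lemma csmoothN f : csmooth O f -> csmooth O (fun q => - f q).
Proof.
move=> sf; apply: eq_csmooth (csmoothM (csmooth_cst (-1)) sf) => q _.
by rewrite mulN1r.
Qed.

Lemma csmooth_sum (I : Type) (r : seq I) (f : I -> T -> C) :
  (forall i, csmooth O (f i)) -> csmooth O (fun q => \sum_(i <- r) f i q).
Proof.
move=> sf; elim: r => [|i r ih].
  by apply: eq_csmooth (csmooth_cst 0) => q _; rewrite big_nil.
by apply: eq_csmooth (csmoothD (sf i) ih) => q _; rewrite big_cons.
Qed.

Lemma csmooth_cderive f v : csmooth O f -> csmooth O (cderive f v).
Proof.
move=> [rf mf]; apply: csmoothD; last apply: csmoothM.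
- by apply: csmooth_toC => k; exact: Ck_rderive (rf k.+1).
- exact: csmooth_cst.
- by apply: csmooth_toC => k; exact: Ck_rderive (mf k.+1).
Qed.

Lemma csmooth_wirt e f : csmooth O f -> csmooth O (wirt e f).
Proof.
move=> sf; apply: csmoothM; last exact: csmooth_cst.
apply: csmoothD; first exact: csmooth_cderive.
apply: csmoothN; apply: csmoothM; first exact: csmooth_cst.
exact: csmooth_cderive.
Qed.

Lemma csmooth_wirtb e f : csmooth O f -> csmooth O (wirtb e f).
Proof.
move=> sf; apply: csmoothM; last exact: csmooth_cst.
apply: csmoothD; first exact: csmooth_cderive.
apply: csmoothM; first exact: csmooth_cst.
exact: csmooth_cderive.
Qed.

Lemma csmooth_comp_affine O' f (phi phi0 : T -> T) :
  (forall p v (t : R), phi (p + toC t *: v) = phi p + toC t *: phi0 v) ->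
  continuous phi -> (forall p, O' p -> O (phi p)) ->
  csmooth O f -> csmooth O' (fun q => f (phi q)).
Proof.
move=> aff cphi OO [rf mf]; split=> k.
  exact: (Ck_comp_affine aff cphi OO (rf k)).
exact: (Ck_comp_affine aff cphi OO (mf k)).
Qed.

Lemma eq_cderive f g v p : O p -> (forall q, O q -> f q = g q) ->
  cderive f v p = cderive g v p.
Proof.
move=> Op fg; have part (h : C -> R) :
    rderive (fun q => h (f q)) v p = rderive (fun q => h (g q)) v p.
  by apply: (near_eq_rderive v oO Op _).2 => q Oq; rewrite fg.
by rewrite /cderive (part (fun z => Re z)) (part (fun z => Im z)).
Qed.

Lemma eq_wirt f g e p : O p -> (forall q, O q -> f q = g q) -> wirt e f p = wirt e g p.
Proof. by move=> Op fg; rewrite /wirt !(eq_cderive _ Op fg). Qed.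

Lemma eq_wirtb f g e p : O p -> (forall q, O q -> f q = g q) -> wirtb e f p = wirtb e g p.
Proof. by move=> Op fg; rewrite /wirtb !(eq_cderive _ Op fg). Qed.

Lemma cderive_cst (c : C) v p : cderive (fun=> c) v p = 0.
Proof. by rewrite /cderive !(rderive_cst _ _ _).2 toC0 mulr0 addr0. Qed.

Lemma wirt_cst (c : C) e p : wirt e (fun=> c) p = 0.
Proof. by rewrite /wirt !cderive_cst mulr0 subr0 mul0r. Qed.

Lemma wirtb_cst (c : C) e p : wirtb e (fun=> c) p = 0.
Proof. by rewrite /wirtb !cderive_cst mulr0 addr0 mul0r. Qed.

Section AtPoint.
Variables (p : T) (Op : O p).

Lemma csmooth_rderivable f v : csmooth O f ->
  rderivable (fun q => Re (f q)) p v /\ rderivable (fun q => Im (f q)) p v.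
Proof.
by move=> [rf mf]; split; [exact: Ck_rderivable (rf 1%N) Op | exact: Ck_rderivable (mf 1%N) Op].
Qed.

Lemma cderiveD f g v : csmooth O f -> csmooth O g ->
  cderive (fun q => f q + g q) v p = cderive f v p + cderive g v p.
Proof.
move=> /(csmooth_rderivable v)[rf mf] /(csmooth_rderivable v)[rg mg].
have hr : rderive (fun q => Re (f q + g q)) v p =
    rderive (fun q => Re (f q)) v p + rderive (fun q => Re (g q)) v p.
  rewrite -(rderiveD rf rg).2; congr (rderive _ v p).
  by apply/funext => q; rewrite ReD.
have hi : rderive (fun q => Im (f q + g q)) v p =
    rderive (fun q => Im (f q)) v p + rderive (fun q => Im (g q)) v p.
  rewrite -(rderiveD mf mg).2; congr (rderive _ v p).
  by apply/funext => q; rewrite ImD.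
by rewrite /cderive hr hi !toCD; atomize; ring.
Qed.

Lemma cderiveM f g v : csmooth O f -> csmooth O g ->
  cderive (fun q => f q * g q) v p = f p * cderive g v p + g p * cderive f v p.
Proof.
move=> /(csmooth_rderivable v)[rf mf] /(csmooth_rderivable v)[rg mg].
have dB (h k : T -> R) : rderivable h p v -> rderivable k p v ->
    rderive (fun q => h q - k q) v p = rderive h v p - rderive k v p.
  move=> dh dk; refine (is_derive_rderive _).2; apply: is_deriveB.
    exact: rderivable_is_derive.
  exact: rderivable_is_derive.
have hr : rderive (fun q => Re (f q * g q)) v p =
    Re (f p) * rderive (fun q => Re (g q)) v p + Re (g p) * rderive (fun q => Re (f q)) v p
    - (Im (f p) * rderive (fun q => Im (g q)) v p + Im (g p) * rderive (fun q => Im (f q)) v p).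
  rewrite -(rderiveM rf rg).2 -(rderiveM mf mg).2.
  rewrite -(dB _ _ (rderiveM rf rg).1 (rderiveM mf mg).1); congr (rderive _ v p).
  by apply/funext => q; rewrite ReM.
have hi : rderive (fun q => Im (f q * g q)) v p =
    Re (f p) * rderive (fun q => Im (g q)) v p + Im (g p) * rderive (fun q => Re (f q)) v p
    + (Im (f p) * rderive (fun q => Re (g q)) v p + Re (g p) * rderive (fun q => Im (f q)) v p).
  rewrite -(rderiveM rf mg).2 -(rderiveM mf rg).2.
  rewrite -(rderiveD (rderiveM rf mg).1 (rderiveM mf rg).1).2; congr (rderive _ v p).
  by apply/funext => q; rewrite ImM.
rewrite /cderive hr hi.
move: (f p) (g p) (rderive _ v p) (rderive _ v p) (rderive _ v p) (rderive _ v p).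
by move=> x y a b c d; apply: CplxP; rewrite !ReImE; ring.
Qed.

Lemma cderive_addv f v w : csmooth O f ->
  cderive f (v + w) p = cderive f v p + cderive f w p.
Proof.
move=> [rf mf]; rewrite /cderive.
rewrite (rderive_addv v w oO (rf 1%N) Op) (rderive_addv v w oO (mf 1%N) Op).
by rewrite !toCD; atomize; ring.
Qed.

Lemma cderiveZv f v (c : R) : csmooth O f ->
  cderive f (toC c *: v) p = toC c * cderive f v p.
Proof.
move=> /(csmooth_rderivable v)[rf mf]; rewrite /cderive.
by rewrite (rderiveZv c rf).2 (rderiveZv c mf).2 !toCM; atomize; ring.
Qed.

Lemma wirtD f g e : csmooth O f -> csmooth O g ->
  wirt e (fun q => f q + g q) p = wirt e f p + wirt e g p.
Proof. by move=> sf sg; rewrite /wirt !cderiveD //; atomize; ring. Qed.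

Lemma wirtM f g e : csmooth O f -> csmooth O g ->
  wirt e (fun q => f q * g q) p = f p * wirt e g p + g p * wirt e f p.
Proof. by move=> sf sg; rewrite /wirt !cderiveM //; atomize; ring. Qed.

Lemma wirtbM f g e : csmooth O f -> csmooth O g ->
  wirtb e (fun q => f q * g q) p = f p * wirtb e g p + g p * wirtb e f p.
Proof. by move=> sf sg; rewrite /wirtb !cderiveM //; atomize; ring. Qed.

Lemma wirt_sum (I : Type) (r : seq I) (f : I -> T -> C) e :
  (forall i, csmooth O (f i)) ->
  wirt e (fun q => \sum_(i <- r) f i q) p = \sum_(i <- r) wirt e (f i) p.
Proof.
move=> sf; elim: r => [|i r ih].
  rewrite big_nil -[RHS](wirt_cst 0 e p); apply: eq_wirt => // q _.
  by rewrite big_nil.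
rewrite big_cons -ih -(wirtD e (sf i) (csmooth_sum r sf)).
by apply: eq_wirt => // q _; rewrite big_cons.
Qed.

Lemma wirt_addv f e e' : csmooth O f -> wirt (e + e') f p = wirt e f p + wirt e' f p.
Proof. by move=> sf; rewrite /wirt scalerDr !cderive_addv //; atomize; ring. Qed.

Lemma wirtb_addv f e e' : csmooth O f -> wirtb (e + e') f p = wirtb e f p + wirtb e' f p.
Proof. by move=> sf; rewrite /wirtb scalerDr !cderive_addv //; atomize; ring. Qed.

Lemma cderiveZcv f (c : C) e : csmooth O f ->
  cderive f (c *: e) p =
  toC (Re c) * cderive f e p + toC (Im c) * cderive f (iC R *: e) p.
Proof.
move=> sf; rewrite {1}(CplxE c) scalerDl [iC R * _]mulrC -scalerA.
by rewrite cderive_addv // !cderiveZv.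
Qed.

Lemma wirtZv f (c : C) e : csmooth O f -> wirt (c *: e) f p = c * wirt e f p.
Proof.
move=> sf; rewrite /wirt scalerA (cderiveZcv c e sf) (cderiveZcv (iC R * c) e sf).
rewrite mulrA; congr (_ / _).
generalize (cderive f e p) (cderive f (iC R *: e) p) => A B.
by apply: CplxP; rewrite !ReImE; ring.
Qed.

Lemma wirtbZv f (c : C) e : csmooth O f -> wirtb (c *: e) f p = conjC c * wirtb e f p.
Proof.
move=> sf; rewrite /wirtb scalerA (cderiveZcv c e sf) (cderiveZcv (iC R * c) e sf).
rewrite mulrA; congr (_ / _).
generalize (cderive f e p) (cderive f (iC R *: e) p) => A B.
by apply: CplxP; rewrite !ReImE; ring.
Qed.

(** Writes the zero direction as a multiple, so that homogeneity in the direction makes the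
    derivative vanish in the empty case of the next sums. *)
Lemma fiber0 : (0 : C) *: (0 : T) = (0, 0).
Proof. by rewrite scale0r. Qed.

Lemma fiber_cons (c : C) (x y : vec) : (0, c *: x + y) = c *: ((0, x) : T) + (0, y).
Proof. by apply: injective_projections; rewrite /= ?scaler0 ?addr0. Qed.

(** A contraction with eta becomes a single derivative along the fibre, from which Euler's relations
    can be read. *)
Lemma wirt_fiber f (eta : vec) : csmooth O f ->
  wirt (0, eta) f p = \sum_k deta k f p * eta 0 k.
Proof.
move=> sf; rewrite [in LHS](row_sum_delta eta); elim: index_enum => [|k r ih].
  by rewrite !big_nil -fiber0 (wirtZv 0 0 sf) mul0r.
rewrite !big_cons fiber_cons (wirt_addv _ _ sf) (wirtZv _ _ sf) ih.
by congr (_ + _); exact: mulrC.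
Qed.

Lemma wirtb_fiber f (eta : vec) : csmooth O f ->
  wirtb (0, eta) f p = \sum_k detab k f p * conjC (eta 0 k).
Proof.
move=> sf; rewrite [in LHS](row_sum_delta eta); elim: index_enum => [|k r ih].
  by rewrite !big_nil -fiber0 (wirtbZv 0 0 sf) conjC0 mul0r.
rewrite !big_cons fiber_cons (wirtb_addv _ _ sf) (wirtbZv _ _ sf) ih.
by congr (_ + _); exact: mulrC.
Qed.

End AtPoint.

End SmoothFunctions.

(** * Complex affine changes of variable and fibrewise scaling *)

Section ComplexAffineMaps.
Variables (R : realType) (n : nat).
Local Notation C := (Cplx R).
Local Notation vec := ('rV[Cplx R]_n).
Local Notation T := ('rV[Cplx R]_n * 'rV[Cplx R]_n)%type.
Local Notation Re x := (complex.Re x).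
Local Notation Im x := (complex.Im x).
Implicit Types (f g : T -> C) (p v e : T) (O : set T) (phi : T -> T).

Lemma cderive_comp_affine f phi (phi0 : T -> T) v p :
  (forall p v (t : R), phi (p + toC t *: v) = phi p + toC t *: phi0 v) ->
  cderive (fun q => f (phi q)) v p = cderive f (phi0 v) (phi p).
Proof.
move=> aff; rewrite /cderive /rderive.
rewrite (rderive_comp_affine (fun q => Re (f q)) p v aff).
by rewrite (rderive_comp_affine (fun q => Im (f q)) p v aff).
Qed.

(** Since [phi0] commutes with i, the two real directions in [wirt] go to the two real directions
    along [phi0 e], and holomorphic and antiholomorphic derivatives do not mix. *)
Lemma wirt_comp_affine f phi (phi0 : T -> T) e p :
  (forall p v (t : R), phi (p + toC t *: v) = phi p + toC t *: phi0 v) ->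
  (forall v, phi0 (iC R *: v) = iC R *: phi0 v) ->
  wirt e (fun q => f (phi q)) p = wirt (phi0 e) f (phi p).
Proof. by move=> aff lin; rewrite /wirt !(cderive_comp_affine _ _ _ aff) lin. Qed.

Lemma wirtb_comp_affine f phi (phi0 : T -> T) e p :
  (forall p v (t : R), phi (p + toC t *: v) = phi p + toC t *: phi0 v) ->
  (forall v, phi0 (iC R *: v) = iC R *: phi0 v) ->
  wirtb e (fun q => f (phi q)) p = wirtb (phi0 e) f (phi p).
Proof. by move=> aff lin; rewrite /wirtb !(cderive_comp_affine _ _ _ aff) lin. Qed.

(** Along the lines used below the functions are polynomials of degree at most 2 in the real
    parameter, so the derivative is the linear coefficient. Degree 2 is what F^2 requires. *)
Lemma cderive_quadratic O f v p (c0 c1 c2 : C) : open O -> O p ->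
  (forall t : R, O (p + toC t *: v) ->
    f (p + toC t *: v) = c0 + toC t * c1 + toC (t * t) * c2) ->
  cderive f v p = c1.
Proof.
move=> oO Op fE.
have quad (h : T -> R) (a b c : R) :
    (forall t : R, O (p + toC t *: v) -> h (p + toC t *: v) = a + t * b + t * t * c) ->
    rderive h v p = b.
  move=> hE; refine (is_derive_rderive _).2.
  have lin : is_derive (0 : R) (1 : R) (id : R -> R) 1 by exact: is_derive_id.
  have d := is_deriveD (is_deriveD (is_derive_cst (a : R) (0 : R) (1 : R))
    (is_deriveM lin (is_derive_cst b (0 : R) (1 : R))))
    (is_deriveM (is_deriveM lin lin) (is_derive_cst c (0 : R) (1 : R))).
  have hn : {near (0 : R), (cst a + id * cst b + id * id * cst c) =1 real_line h p v}.
    have := near_line v oO Op; apply: filterS => t Ot.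
    by rewrite /real_line hE.
  apply: DeriveDef.
    by apply: near_eq_derivable hn _; exact: (@ex_derive _ _ _ _ _ _ _ d).
  rewrite -(near_eq_derive _ hn) (@derive_val _ _ _ _ _ _ _ d) /GRing.scale /=.
  by rewrite /cst; ring.
rewrite /cderive (quad _ (Re c0) (Re c1) (Re c2)); last first.
  by move=> t Ot; rewrite fE // !ReImE; ring.
rewrite (quad _ (Im c0) (Im c1) (Im c2)) -?CplxE // => t Ot.
by rewrite fE // !ReImE; ring.
Qed.

Lemma csmooth_linear O (l : T -> C) : open O -> continuous l ->
  (forall p v (t : R), l (p + toC t *: v) = l p + toC t * l v) -> csmooth O l.
Proof.
move=> oO cl lin; split=> k; apply: Ck_linear => //.
- move=> p; apply: (@continuous_comp _ _ _ l (fun z : C => Re z)); first exact: cl.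
  exact: continuous_Re.
- by move=> p v t; rewrite lin !ReImE; ring.
- move=> p; apply: (@continuous_comp _ _ _ l (fun z : C => Im z)); first exact: cl.
  exact: continuous_Im.
- by move=> p v t; rewrite lin !ReImE; ring.
Qed.

Lemma csmooth_fiber_coord O k : open O -> csmooth O (fun q : T => q.2 0 k).
Proof.
move=> oO; apply: csmooth_linear => //.
  move=> p; apply: (@continuous_comp _ _ _ snd (fun M : vec => M 0 k)).
    exact: cvg_snd.
  exact: coord_continuous.
by move=> p v t; rewrite /= !mxE.
Qed.

Lemma csmooth_conjC O f : open O -> csmooth O f -> csmooth O (fun q => conjC (f q)).
Proof.
move=> oO [rf mf]; split=> k; first by apply: eq_Ck (rf k) => // q _; rewrite Re_conjC.
by apply: eq_Ck (CkN oO (mf k)) => // q _; rewrite Im_conjC.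
Qed.

Lemma dz_fiber_const (h : vec -> C) (k : 'I_n) p : dz k (fun q : T => h q.2) p = 0.
Proof.
have c (v : vec) : cderive (fun q : T => h q.2) (v, 0) p = 0.
  apply: (@cderive_quadratic setT _ _ _ (h p.2) 0 0) => //; first exact: openT.
  by move=> t _ /=; rewrite scaler0 addr0 !mulr0 !addr0.
rewrite /dz /wirt c; have -> : iC R *: (unit_vec R k, 0 : vec) = (iC R *: unit_vec R k, 0).
  by apply: injective_projections; rewrite /= ?scaler0.
by rewrite c mulr0 subr0 mul0r.
Qed.

(** This map is its own linear part in the chain rules above; for [c] equal to [iC R] it is the
    rotation J. *)
Definition fscale (c : C) (p : T) : T := (p.1, c *: p.2).

Lemma fscale_affine c p v (t : R) :
  fscale c (p + toC t *: v) = fscale c p + toC t *: fscale c v.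
Proof.
apply: injective_projections => //=.
by rewrite scalerDr !scalerA [c * _]mulrC.
Qed.

Lemma fscale_iC c v : fscale c (iC R *: v) = iC R *: fscale c v.
Proof. by apply: injective_projections; rewrite //= !scalerA [c * _]mulrC. Qed.

Lemma fscale_base c (e : vec) : fscale c (e, 0) = (e, 0).
Proof. by rewrite /fscale /= scaler0. Qed.

End ComplexAffineMaps.

Section Tangent.
Variables (R : realType) (n : nat).
Local Notation C := (Cplx R).
Local Notation vec := ('rV[Cplx R]_n).
Local Notation T := ('rV[Cplx R]_n * 'rV[Cplx R]_n)%type.
Variables (D : set vec) (oD : open D).

Lemma open_tangent : open (tangent D).
Proof.
apply: (@open_comp _ _ fst D) => // p _; exact: cvg_fst.
Qed.

Lemma open_slit_tangent : open (slit_tangent D).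
Proof.
have -> : slit_tangent D = tangent D `&` (snd @^-1` (~` [set 0 : vec])).
  by apply/seteqP; split => p /= [? /eqP ?]; split => //; apply/eqP.
apply: openI; first exact: open_tangent.
apply: (@open_comp _ _ snd); first by move=> p _; exact: cvg_snd.
apply: closed_openC; apply: accessible_closed_set1.
exact/hausdorff_accessible/norm_hausdorff.
Qed.

Lemma fscale_slit c (p : T) : c != 0 -> slit_tangent D p -> slit_tangent D (fscale c p).
Proof.
by move=> c0 [Dp p0]; split => //=; rewrite scaler_eq0 negb_or c0.
Qed.

End Tangent.

(** * Identities for a complex Finsler metric *)

Section HermitianForm.
Variables (R : realType) (n : nat).
Local Notation C := (Cplx R).
Local Notation vec := ('rV[Cplx R]_n).
Local Notation Re x := (complex.Re x).
Local Notation Im x := (complex.Im x).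

Definition sesq (g : 'M[C]_n) (u v : vec) : C :=
  \sum_i \sum_j g i j * u 0 i * conjC (v 0 j).

Definition pos_def (g : 'M[C]_n) := forall v : vec, v != 0 -> 0 < sesq g v v.

Variable g : 'M[C]_n.

Lemma sesq_addl u u' v : sesq g (u + u') v = sesq g u v + sesq g u' v.
Proof.
rewrite /sesq -big_split; apply: eq_bigr => i _ /=; rewrite -big_split.
by apply: eq_bigr => j _ /=; rewrite mxE; ring.
Qed.

Lemma sesq_addr u v v' : sesq g u (v + v') = sesq g u v + sesq g u v'.
Proof.
rewrite /sesq -big_split; apply: eq_bigr => i _ /=; rewrite -big_split.
by apply: eq_bigr => j _ /=; rewrite mxE conjCD; ring.
Qed.

Lemma sesqZl c u v : sesq g (c *: u) v = c * sesq g u v.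
Proof.
rewrite /sesq big_distrr; apply: eq_bigr => i _ /=; rewrite big_distrr.
by apply: eq_bigr => j _ /=; rewrite mxE; ring.
Qed.

Lemma sesqZr c u v : sesq g u (c *: v) = conjC c * sesq g u v.
Proof.
rewrite /sesq big_distrr; apply: eq_bigr => i _ /=; rewrite big_distrr.
by apply: eq_bigr => j _ /=; rewrite mxE conjCM; ring.
Qed.

Lemma unit_vecE (i k : 'I_n) : unit_vec R i 0 k = (k == i)%:R :> C.
Proof. by rewrite /unit_vec mxE. Qed.

Lemma sesq_delta i j : sesq g (unit_vec R i) (unit_vec R j) = g i j.
Proof.
rewrite /sesq (bigD1 i) //= [X in _ + X]big1 => [|k /negbTE ki]; last first.
  by apply: big1 => l _; rewrite unit_vecE ki mulr0 mul0r.
rewrite addr0 (bigD1 j) //= [X in _ + X]big1 => [|k /negbTE kj]; last first.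
  by rewrite [in X in conjC X]unit_vecE kj conjC0 mulr0.
by rewrite !unit_vecE !eqxx conjC1 !mulr1 addr0.
Qed.

Lemma sesq_mulmx u v : sesq g u v = \sum_j (u *m g) 0 j * conjC (v 0 j).
Proof.
rewrite /sesq exchange_big; apply: eq_bigr => j _ /=.
by rewrite mxE big_distrl; apply: eq_bigr => i _ /=; ring.
Qed.

Hypothesis gP : pos_def g.

(** A nonzero row vector in the kernel would be isotropic. *)
Lemma pos_def_unitmx : g \in unitmx.
Proof.
rewrite -row_free_unit -kermx_eq0; apply/negPn/negP => /rowV0Pn[v /sub_kermxP vg v0].
have := gP v0; rewrite sesq_mulmx vg big1 ?ltxx // => j _.
by rewrite mxE mul0r.
Qed.

(* Polarization: the values of the form on the diagonal are real. *)
Lemma pos_def_hermitian i j : g j i = conjC (g i j).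
Proof.
have real u : Im (sesq g u u) = 0.
  have [->|u0] := eqVneq u 0.
    by rewrite -(scale0r (0 : vec)) sesqZl mul0r.
  by rewrite (gt0_toC (gP u0)) Im_toC.
rewrite -!sesq_delta.
set u := unit_vec R i; set v := unit_vec R j.
have r1 := real (u + v); have r2 := real (u + iC R *: v).
move: r1 r2; rewrite !(sesq_addl, sesq_addr, sesqZl, sesqZr) !ReImE !real.
move: (sesq g u v) (sesq g v u) => x y r1 r2.
by apply: CplxP; rewrite !ReImE; lra.
Qed.

End HermitianForm.

Section FinslerIdentities.
Variables (R : realType) (n : nat).
Local Notation C := (Cplx R).
Local Notation vec := ('rV[Cplx R]_n).
Local Notation T := ('rV[Cplx R]_n * 'rV[Cplx R]_n)%type.
Local Notation Re x := (complex.Re x).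
Local Notation Im x := (complex.Im x).
Variables (D : set vec) (oD : open D) (F : T -> R).
Hypothesis hF : complex_Finsler D F.
Local Notation O := (slit_tangent D).
Let oO : open O := open_slit_tangent oD.
Implicit Types (f : T -> C) (p v e : T).

Lemma Finsler_csmooth : csmooth O (fun p => toC (F p)).
Proof. by apply: csmooth_toC => //; case: hF. Qed.

Lemma sqF_csmooth : csmooth O (sqF F).
Proof.
apply: eq_csmooth (csmoothM oO Finsler_csmooth Finsler_csmooth) => // q _.
by rewrite /sqF expr2 toCM.
Qed.

Lemma Finsler_neq0 p : O p -> toC (F p) != 0.
Proof.
case: p => z eta [/= Dz eta0]; case: hF => _ _ + _ _ => /(_ z eta Dz)[_ F0].
by rewrite toC_eq0; apply: contra eta0 => /eqP /F0 ->.
Qed.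

Lemma Finsler_fscale c p : D p.1 -> toC (F (fscale c p)) = `|c| * toC (F p).
Proof. by case: p => z eta Dz; case: hF => _ _ _ + _; exact. Qed.

Lemma sqF_fscale c p : D p.1 -> sqF F (fscale c p) = c * conjC c * sqF F p.
Proof.
by move=> Dp; rewrite /sqF !expr2 !toCM !Finsler_fscale // -norm_conjC; ring.
Qed.

Lemma fundamental_pos_def p : O p -> pos_def (fundamental F p).
Proof. by move=> Op v v0; case: hF => _ _ _ _; exact. Qed.

Lemma detab_sqF_csmooth m : csmooth O (detab m (sqF F)).
Proof. by apply: csmooth_wirtb => //; exact: sqF_csmooth. Qed.

Lemma fundamental_csmooth i m : csmooth O (fun q => fundamental F q i m).
Proof.
apply: eq_csmooth (csmooth_wirt oO (0, unit_vec R i) (detab_sqF_csmooth m)) => // q _.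
by rewrite mxE.
Qed.

(** In this lemma and the next two the factor [c] is free because several degrees occur: lambda
    conj(lambda) for F^2, lambda for its conjugate fibre derivative, 1 for g and |lambda| for F. *)
Lemma detab_fscale f (lambda c : C) m p : csmooth O f -> lambda != 0 -> O p ->
  (forall q, O q -> f (fscale lambda q) = c * f q) ->
  conjC lambda * detab m f (fscale lambda p) = c * detab m f p.
Proof.
move=> sf l0 Op fE.
rewrite -(wirtbZv oO (@fscale_slit _ _ D lambda p l0 Op) lambda _ sf).
have -> : lambda *: (0, unit_vec R m) = fscale lambda (0, unit_vec R m) :> T.
  by apply: injective_projections; rewrite //= scaler0.
rewrite -(wirtb_comp_affine f _ _ (fscale_affine lambda) (fscale_iC lambda)).
rewrite (eq_wirtb oO _ Op fE) (wirtbM Op _ (csmooth_cst oO c) sf).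
by rewrite wirtb_cst mulr0 addr0.
Qed.

Lemma deta_fscale f (lambda c : C) l p : csmooth O f -> lambda != 0 -> O p ->
  (forall q, O q -> f (fscale lambda q) = c * f q) ->
  lambda * deta l f (fscale lambda p) = c * deta l f p.
Proof.
move=> sf l0 Op fE.
rewrite -(wirtZv oO (@fscale_slit _ _ D lambda p l0 Op) lambda _ sf).
have -> : lambda *: (0, unit_vec R l) = fscale lambda (0, unit_vec R l) :> T.
  by apply: injective_projections; rewrite //= scaler0.
rewrite -(wirt_comp_affine f _ _ (fscale_affine lambda) (fscale_iC lambda)).
rewrite (eq_wirt oO _ Op fE) (wirtM Op _ (csmooth_cst oO c) sf).
by rewrite wirt_cst mulr0 addr0.
Qed.

Lemma dz_fscale f (lambda c : C) k p : csmooth O f -> O p ->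
  (forall q, O q -> f (fscale lambda q) = c * f q) ->
  dz k f (fscale lambda p) = c * dz k f p.
Proof.
move=> sf Op fE.
rewrite /dz -[X in wirt X f (fscale _ _)](fscale_base lambda (unit_vec R k)).
rewrite -(wirt_comp_affine f _ _ (fscale_affine lambda) (fscale_iC lambda)).
rewrite (eq_wirt oO _ Op fE) (wirtM Op _ (csmooth_cst oO c) sf).
by rewrite wirt_cst mulr0 addr0.
Qed.

Lemma detab_sqF_fscale m lambda p : lambda != 0 -> O p ->
  detab m (sqF F) (fscale lambda p) = lambda * detab m (sqF F) p.
Proof.
move=> l0 Op; have cl0 : conjC lambda != 0.
  by apply: contra l0 => /eqP e; rewrite -[lambda]conjCK e conjC0.
apply: (mulfI cl0); rewrite (detab_fscale (c := lambda * conjC lambda) _ sqF_csmooth l0 Op).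
  by move: (detab _ _ _) => x; ring.
by move=> q [Dq _]; rewrite sqF_fscale.
Qed.

(** The two fibre derivatives absorb the factors conj(lambda) and lambda of F^2. *)
Lemma fundamental_fscale lambda p : lambda != 0 -> O p ->
  fundamental F (fscale lambda p) = fundamental F p.
Proof.
move=> l0 Op; apply/matrixP => i m; rewrite [LHS]mxE [RHS]mxE; apply: (mulfI l0).
exact: (deta_fscale i (detab_sqF_csmooth m) l0 Op
  (fun q Oq => detab_sqF_fscale m l0 Oq)).
Qed.

Lemma fiber_line p (t : R) : p + toC t *: (0, p.2) = fscale (1 + toC t) p.
Proof. by apply: injective_projections; rewrite /= ?scaler0 ?addr0 // scalerDl scale1r. Qed.

Lemma fiber_line_iC p (t : R) :
  p + toC t *: (iC R *: (0, p.2)) = fscale (1 + iC R * toC t) p.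
Proof.
apply: injective_projections; rewrite /= ?scaler0 ?addr0 //.
by rewrite scalerDl scale1r scalerA mulrC.
Qed.

Lemma fscale_slit_neq0 c p : O (fscale c p) -> c != 0.
Proof. by move=> [_ /=]; rewrite scaler_eq0 negb_or => /andP[]. Qed.

(** Moving along eta and along i eta multiplies [f] by 1 + t and by 1 + i t; the derivatives are f
    and i f, and (f - i (i f)) / 2 = f. *)
Lemma Euler_holomorphic f p : O p ->
  (forall lambda, lambda != 0 -> f (fscale lambda p) = lambda * f p) ->
  wirt (0, p.2) f p = f p.
Proof.
move=> Op fE; rewrite /wirt.
rewrite (cderive_quadratic (c0 := f p) (c1 := f p) (c2 := 0) oO Op); last first.
  move=> t; rewrite fiber_line => /fscale_slit_neq0 /fE ->; ring.
rewrite (cderive_quadratic (c0 := f p) (c1 := iC R * f p) (c2 := 0) oO Op); last first.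
  move=> t; rewrite fiber_line_iC => /fscale_slit_neq0 /fE ->; ring.
by rewrite mulrA iCiC mulN1r opprK; field.
Qed.

(** Here the factors are |1 + t|^2 = 1 + 2 t + t^2 and |1 + i t|^2 = 1 + t^2, so the two derivatives
    are 2 F^2 and 0. *)
Lemma Euler_sqF p : O p ->
  \sum_m detab m (sqF F) p * conjC (p.2 0 m) = sqF F p.
Proof.
move=> Op; rewrite -(wirtb_fiber oO Op _ sqF_csmooth) /wirtb.
rewrite (cderive_quadratic (c0 := sqF F p) (c1 := sqF F p + sqF F p) (c2 := sqF F p)
  oO Op); last first.
  move=> t; rewrite fiber_line => _; rewrite sqF_fscale ?Op.1 //; last by case: Op.
  by rewrite conjCD conjC1 conjC_toC toCM; ring.
rewrite (cderive_quadratic (c0 := sqF F p) (c1 := 0) (c2 := sqF F p) oO Op); last first.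
  move=> t; rewrite fiber_line_iC => _; rewrite sqF_fscale; last by case: Op.
  rewrite conjCD conjCM conjC1 conjC_iC conjC_toC toCM.
  by move: (sqF F p) => x; apply: CplxP; rewrite !ReImE; ring.
by rewrite mulr0 addr0; field.
Qed.

Lemma Euler_fundamental m p : O p ->
  \sum_l fundamental F p l m * p.2 0 l = detab m (sqF F) p.
Proof.
move=> Op; have <- := Euler_holomorphic (f := detab m (sqF F)) Op.
  rewrite (wirt_fiber oO Op _ (detab_sqF_csmooth m)).
  by apply: eq_bigr => l _; rewrite mxE.
by move=> lambda l0; exact: detab_sqF_fscale.
Qed.

Lemma ginv_fundamental p m r : O p ->
  \sum_i ginv F p m i * fundamental F p i r = (m == r)%:R.
Proof.
move=> Op; have := mulVmx (pos_def_unitmx (fundamental_pos_def Op)).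
by move=> /matrixP /(_ m r); rewrite !mxE.
Qed.

(* Lowering the index of a vector written as [g^{m-bar i} w_m]. *)
Lemma lower_raise p (w : 'I_n -> C) r : O p ->
  \sum_i (\sum_m ginv F p m i * w m) * fundamental F p i r = w r.
Proof.
move=> Op; under eq_bigr do rewrite big_distrl.
rewrite exchange_big (bigD1 r) //= [X in _ + X]big1 => [|m mr]; last first.
  under eq_bigr do rewrite mulrAC.
  by rewrite -big_distrl /= ginv_fundamental // (negbTE mr) mul0r.
under eq_bigr do rewrite mulrAC.
by rewrite -big_distrl /= ginv_fundamental // eqxx mul1r addr0.
Qed.

(** Euler's relation for g differentiated in z; eta is constant in z, so only g is
    differentiated. *)
Lemma dz_detab_sqF j m p : O p ->
  \sum_l dz j (fun q => fundamental F q l m) p * p.2 0 l = dz j (detab m (sqF F)) p.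
Proof.
move=> Op; rewrite /dz -(eq_wirt oO _ Op (fun q Oq => Euler_fundamental m Oq)).
have sc l := csmooth_fiber_coord l oO.
rewrite (wirt_sum oO Op) => [|l]; last exact: csmoothM (fundamental_csmooth l m) (sc l).
apply: eq_bigr => l _; rewrite (wirtM Op _ (fundamental_csmooth l m) (sc l)).
have -> : wirt (unit_vec R j, 0) (fun q : T => q.2 0 l) p = 0.
  exact: (dz_fiber_const (fun v : vec => v 0 l)).
by rewrite mulr0 add0r mulrC.
Qed.

Lemma dz_sqF_Euler j p : O p ->
  \sum_m dz j (detab m (sqF F)) p * conjC (p.2 0 m) = dz j (sqF F) p.
Proof.
move=> Op; rewrite /dz -(eq_wirt oO _ Op (fun q Oq => Euler_sqF Oq)).
have sc m := csmooth_conjC oO (csmooth_fiber_coord m oO).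
rewrite (wirt_sum oO Op) => [|m]; last exact: csmoothM (detab_sqF_csmooth m) (sc m).
apply: eq_bigr => m _; rewrite (wirtM Op _ (detab_sqF_csmooth m) (sc m)).
have -> : wirt (unit_vec R j, 0) (fun q : T => conjC (q.2 0 m)) p = 0.
  exact: (dz_fiber_const (fun v : vec => conjC (v 0 m))).
by rewrite mulr0 add0r mulrC.
Qed.

Lemma dz_sqF j p : O p -> dz j (sqF F) p = 2 * toC (F p) * dz j (fun q => toC (F q)) p.
Proof.
move=> Op; rewrite /dz.
have sE q : O q -> sqF F q = toC (F q) * toC (F q) by rewrite /sqF expr2 toCM.
rewrite (eq_wirt oO _ Op sE) (wirtM Op _ Finsler_csmooth Finsler_csmooth).
by rewrite -mulrA mulr_natl mulr2n.
Qed.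

(** Brings G^i to the form g^{m-bar i} w_m, to which [lower_raise] applies. *)
Lemma spray_raise i p : O p ->
  spray F i p = \sum_m ginv F p m i * ((\sum_j dz j (detab m (sqF F)) p * p.2 0 j) / 2).
Proof.
move=> Op; rewrite /spray /CF big_distrl /=.
under eq_bigr do rewrite big_distrl big_distrl /=.
rewrite exchange_big; apply: eq_bigr => m _ /=.
rewrite !big_distrl big_distrr; apply: eq_bigr => j _ /=.
rewrite -dz_detab_sqF // !big_distrl big_distrr; apply: eq_bigr => l _ /=.
by rewrite !mulrA.
Qed.

(** The function Q. Every term of the sum contains a coordinate of eta, so its value on the zero
    section is 0. *)
Definition radial (p : T) : C :=
  (toC (F p))^-1 * (\sum_k dz k (fun q => toC (F q)) p * p.2 0 k).

Lemma spray_contract p : O p ->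
  \sum_r (\sum_i spray F i p * fundamental F p i r) * conjC (p.2 0 r) =
  radial p * sqF F p.
Proof.
move=> Op.
transitivity (\sum_r \sum_j dz j (detab r (sqF F)) p * p.2 0 j / 2 * conjC (p.2 0 r)).
  apply: eq_bigr => r _; rewrite -big_distrl /=; congr (_ * _).
  under eq_bigr do rewrite spray_raise //.
  by rewrite lower_raise // big_distrl.
rewrite exchange_big /=.
transitivity (\sum_j toC (F p) * (dz j (fun q => toC (F q)) p * p.2 0 j)).
  apply: eq_bigr => j _.
  have := dz_sqF_Euler j Op; rewrite dz_sqF // => e.
  apply: (@mulfI _ 2); first by rewrite pnatr_eq0.
  rewrite [RHS]mulrA [RHS]mulrA -e big_distrl big_distrr; apply: eq_bigr => r _ /=.
  by move: (dz _ _ _) => x; field.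
rewrite -big_distrr /= /radial /sqF expr2 toCM.
have := Finsler_neq0 Op; move: (toC (F p)) (\sum_k _) => x y x0.
by field.
Qed.

(** This is theta* with its index lowered, and at the same time the conjugate of the expression in
    the weakly Kähler condition. *)
Definition torsion_form (k : 'I_n) (p : T) : C :=
  \sum_h \sum_r \sum_j fundamental F p h r *
    (conjC (CFL F r j k p) - conjC (CFL F r k j p)) * p.2 0 h * conjC (p.2 0 j).

Lemma theta_raise i p : theta F i p = \sum_m ginv F p m i * torsion_form m p.
Proof.
rewrite /theta /torsion_form; apply: eq_bigr => m _.
rewrite big_distrr; apply: eq_bigr => h _ /=.
rewrite big_distrr; apply: eq_bigr => r _ /=.
rewrite big_distrr; apply: eq_bigr => j _ /=.
by rewrite !mulrA.
Qed.

Lemma torsion_form_contract p : \sum_k torsion_form k p * conjC (p.2 0 k) = 0.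
Proof.
pose A (h r j k : 'I_n) := fundamental F p h r * conjC (CFL F r j k p) * p.2 0 h *
  conjC (p.2 0 j) * conjC (p.2 0 k).
pose B (k j : 'I_n) := \sum_h \sum_r A h r j k.
transitivity (\sum_k \sum_j (B k j - B j k)).
  apply: eq_bigr => k _; rewrite /torsion_form /B.
  transitivity (\sum_j \sum_h \sum_r (A h r j k - A h r k j)); last first.
    by apply: eq_bigr => j _; rewrite -sumrB; apply: eq_bigr => h _; rewrite -sumrB.
  rewrite big_distrl exchange_big; apply: eq_bigr => h _ /=.
  rewrite big_distrl exchange_big; apply: eq_bigr => r _ /=.
  rewrite big_distrl; apply: eq_bigr => j _ /=.
  rewrite /A; move: (fundamental F p h r) (CFL F r j k p) (CFL F r k j p) => x y z.
  by ring.
under eq_bigr do rewrite sumrB.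
by rewrite sumrB [X in _ - X]exchange_big subrr.
Qed.

Lemma conjC_weak_torsion k p : O p ->
  conjC (\sum_i \sum_j \sum_l fundamental F p i l *
      (CFL F i j k p - CFL F i k j p) * p.2 0 j * conjC (p.2 0 l)) = torsion_form k p.
Proof.
move=> Op; rewrite /torsion_form [RHS]exchange_big conjC_sum; apply: eq_bigr => i _ /=.
rewrite [RHS]exchange_big conjC_sum; apply: eq_bigr => j _ /=.
rewrite conjC_sum; apply: eq_bigr => l _.
rewrite (pos_def_hermitian (fundamental_pos_def Op) i l).
move: (fundamental F p i l) (CFL F i j k p) (CFL F i k j p) => x y z.
by rewrite !(conjCM, conjCD, conjCN) conjCK; ring.
Qed.

(** Combined with [theta_raise] and [torsion_form_theta], this identifies weak Kählerness with the
    vanishing of theta* off the zero section. *)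
Lemma weakly_KahlerP :
  weakly_Kahler D F <-> (forall k p, O p -> torsion_form k p = 0).
Proof.
split=> wK k p Op; first by rewrite -conjC_weak_torsion // wK // conjC0.
by rewrite -[LHS]conjCK conjC_weak_torsion // wK // conjC0.
Qed.

Lemma torsion_form_theta k p : O p ->
  \sum_i theta F i p * fundamental F p i k = torsion_form k p.
Proof.
by move=> Op; under eq_bigr do rewrite theta_raise; rewrite lower_raise.
Qed.

Lemma cderive_iC f v p : cderive (fun q => iC R * f q) v p = iC R * cderive f v p.
Proof.
have hr : (fun q => Re (iC R * f q)) = (fun q => - Im (f q)).
  by apply/funext => q; rewrite !ReImE; ring.
have hi : (fun q => Im (iC R * f q)) = (fun q => Re (f q)).
  by apply/funext => q; rewrite !ReImE; ring.
rewrite /cderive hr hi rderiveN_junk; atomize.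
by apply: CplxP; rewrite !ReImE; ring.
Qed.

Lemma cderive_oppv f v p : cderive f (- v) p = - cderive f v p.
Proof. by rewrite /cderive !rderive_oppv_junk !toCN; atomize; ring. Qed.

(* Needs no differentiability of [f]: only multiplications by [iC] and changes
   of sign occur, and these are compatible with the value 0 of the derivative
   of a non-differentiable function. *)
Lemma deta_rotation f k p : O p ->
  (forall q, O q -> f (fscale (iC R) q) = iC R * f q) ->
  deta k f (fscale (iC R) p) = deta k f p.
Proof.
move=> Op fE; pose e : T := (0, unit_vec R k).
have eE : e = fscale (iC R) (- (iC R *: e)).
  apply: injective_projections; rewrite /= ?scaler0 ?oppr0 //.
  by rewrite scalerN scalerA iCiC scaleN1r opprK.
rewrite /deta -/e [in LHS]eE.
rewrite -(wirt_comp_affine f _ _ (fscale_affine _) (fscale_iC _)) (eq_wirt oO _ Op fE).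
rewrite /wirt scalerN scalerA iCiC scaleN1r opprK !cderive_iC cderive_oppv; congr (_ / _).
generalize (cderive f e p) (cderive f (iC R *: e) p) => A B.
by apply: CplxP; rewrite !ReImE; ring.
Qed.

Lemma CF_rotation i k p : O p -> CF F i k (fscale (iC R) p) = iC R * CF F i k p.
Proof.
move=> Op; rewrite /CF big_distrr; apply: eq_bigr => m _ /=.
rewrite big_distrr; apply: eq_bigr => l _ /=.
rewrite /ginv (fundamental_fscale (iC_neq0 R) Op).
rewrite (@dz_fscale _ _ 1 _ _ (fundamental_csmooth l m) Op); last first.
  by move=> q Oq; rewrite (fundamental_fscale (iC_neq0 R) Oq) mul1r.
rewrite [in LHS]mxE.
move: (dz k (fun q : T => fundamental F q l m) p) (invmx (fundamental F p) m i) => x y.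
by ring.
Qed.

Lemma CFL_rotation i j k p : O p -> CFL F i j k (fscale (iC R) p) = CFL F i j k p.
Proof. by move=> Op; apply: deta_rotation => // q Oq; exact: CF_rotation. Qed.

Lemma spray_rotation i p : O p -> spray F i (fscale (iC R) p) = - spray F i p.
Proof.
move=> Op; rewrite /spray -mulNr -sumrN; congr (_ / _); apply: eq_bigr => j _.
by rewrite (CF_rotation _ _ Op) mxE; move: (CF F i j p) => x; rewrite mulrACA iCiC mulN1r.
Qed.

Lemma theta_rotation i p : O p -> theta F i (fscale (iC R) p) = theta F i p.
Proof.
move=> Op; apply: eq_bigr => m _; apply: eq_bigr => h _; apply: eq_bigr => r _.
apply: eq_bigr => j _.
rewrite /ginv (fundamental_fscale (iC_neq0 R) Op) !CFL_rotation //.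
rewrite (_ : (fscale _ _).2 0 h = iC R * p.2 0 h); last by rewrite mxE.
rewrite (_ : (fscale _ _).2 0 j = iC R * p.2 0 j); last by rewrite mxE.
move: (invmx (fundamental F p) m i) (fundamental F p h r) (CFL F r j m p)
  (CFL F r m j p) (p.2 0 h) (p.2 0 j) => x y z w a b.
by apply: CplxP; rewrite !ReImE; ring.
Qed.

(** The factors |c| from the inverse of F and from its z-derivatives cancel, leaving the c of the
    explicit eta. The cases c = 0 and eta = 0 are included, since fibrewise linearity will be
    deduced from homogeneity on whole fibres. *)
Lemma radial_fscale c p : D p.1 -> radial (fscale c p) = c * radial p.
Proof.
move=> Dp; have [->|c0] := eqVneq c 0.
  rewrite mul0r /radial big1 ?mulr0 // => k _.
  by rewrite /= scale0r mxE mulr0.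
have [p0|p0] := eqVneq p.2 0.
  have z q : q.2 = 0 -> radial q = 0.
    by move=> q0; rewrite /radial big1 ?mulr0 // => k _; rewrite q0 mxE mulr0.
  by rewrite !z ?mulr0 //= p0 scaler0.
have Op : O p by [].
rewrite /radial Finsler_fscale // invfM.
have -> : \sum_k dz k (fun q => toC (F q)) (fscale c p) * (fscale c p).2 0 k =
    `|c| * c * \sum_k dz k (fun q => toC (F q)) p * p.2 0 k.
  rewrite big_distrr; apply: eq_bigr => k _ /=.
  rewrite (@dz_fscale _ _ `|c| _ _ Finsler_csmooth Op); last first.
    by move=> q [Dq _]; exact: Finsler_fscale.
  by rewrite mxE; move: (dz _ _ _) => x; ring.
have n0 : `|c| != 0 by rewrite normr_eq0.
move: (\sum_k _) (toC (F p))^-1 (`|c|) n0 => x y m m0.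
by field.
Qed.

Lemma radial_csmooth : csmooth O radial.
Proof.
apply: csmoothM => //.
  have Fn0 p : O p -> F p != 0 by move=> Op; rewrite -toC_eq0; exact: Finsler_neq0.
  have sF : smooth O (fun p => (F p)^-1).
    by move=> k; apply: CkV => //; case: hF => _ + _ _ _; exact.
  by apply: eq_csmooth (csmooth_toC oO sF) => // q _; rewrite toCV.
apply: csmooth_sum => // k; apply: csmoothM => //; last exact: csmooth_fiber_coord.
by apply: csmooth_wirt => //; exact: Finsler_csmooth.
Qed.

End FinslerIdentities.

(** * Holomorphic homogeneous functions are linear *)

Section MaximumPrinciple.
Variable R : realType.

(** If [d] were positive, [dg], which vanishes at [a], would be positive just to its right, and the
    mean value theorem would give a value of [g] above the maximum. *)
Lemma second_derivative_at_max (g dg : R -> R) (a d r : R) : 0 < r ->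
  (forall x : R, `|x - a| < r -> is_derive x 1 g (dg x)) -> is_derive a 1 dg d ->
  (forall x : R, `|x - a| < r -> g x <= g a) -> d <= 0.
Proof.
move=> r0 hg hdg gmax; rewrite leNgt; apply/negP => d0.
have inr (x : R) : x \in `]a - r, a + r[ -> `|x - a| < r.
  by rewrite in_itv /= => /andP[ax xa]; rewrite ltr_distl ax xa.
have aa : `|a - a| < r by rewrite subrr normr0.
have dga0 : dg a = 0.
  have h : is_derive a 1 g 0.
    apply: (@derive1_at_max R g (a - r) (a + r) a).
    - by lra.
    - by move=> t /inr tr; exact: (@ex_derive _ _ _ _ _ _ _ (hg t tr)).
    - by rewrite in_itv /=; apply/andP; split; lra.
    - by move=> t /inr tr; exact: gmax.
  by rewrite -(@derive_val _ _ _ _ _ _ _ (hg a aa)) (@derive_val _ _ _ _ _ _ _ h).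
have [e e0 he] : exists2 e : R, 0 < e & forall h : R, 0 < h -> h < e -> 0 < dg (a + h).
  have cv : (fun h : R => h^-1 *: (dg (h *: 1 + a) - dg a)) @ 0^' --> d.
    have -> : d = lim ((fun h : R => h^-1 *: (dg (h *: 1 + a) - dg a)) @ 0^').
      by rewrite -[LHS](@derive_val _ _ _ _ _ _ _ hdg).
    exact: (@ex_derive _ _ _ _ _ _ _ hdg).
  have /cvgrPdist_lt /(_ d d0) := cv.
  rewrite /dnbhs /= /within /= => /nbhs_ballP[e /= e0 he]; exists e => // h h0 hle.
  have : `|d - h^-1 *: (dg (h *: 1 + a) - dg a)| < d.
    apply: he; last by rewrite gt_eqF.
    by rewrite /ball /= sub0r normrN gtr0_norm.
  rewrite dga0 subr0 [h *: 1]mulr1 (addrC h) ltr_distlC subrr => /andP[+ _].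
  by rewrite [_ *: _]mulrC pmulr_lgt0 ?invr_gt0.
pose b := a + Num.min r e / 2.
have m0 : 0 < Num.min r e by rewrite lt_min r0.
have mr : Num.min r e <= r by rewrite ge_min lexx.
have me : Num.min r e <= e by rewrite ge_min lexx orbT.
have ab : a < b by rewrite /b; lra.
have inb (x : R) : x \in `[a, b] -> `|x - a| < r.
  by rewrite in_itv /= ltr_distl /b => /andP[ax xb]; apply/andP; split; lra.
have der (x : R) : x \in `]a, b[ -> is_derive x 1 g (dg x).
  by move=> xab; apply/hg/inb; exact: subset_itv_oo_cc.
have gc : {within `[a, b], continuous g}.
  apply: derivable_within_continuous => x /inb xr.
  exact: (@ex_derive _ _ _ _ _ _ _ (hg x xr)).
have [c cab gE] := MVT ab der gc.
have bab : b \in `[a, b] by rewrite in_itv /= lexx ltW.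
have := gmax b (inb b bab); rewrite -subr_le0 gE leNgt => /negP; apply.
move: cab; rewrite in_itv /= => /andP[ac cb].
apply: mulr_gt0; last by rewrite subr_gt0.
have -> : c = a + (c - a) by ring.
by apply: he; move: cb; rewrite /b; lra.
Qed.

(* If [u] exceeded its limit [c] at infinity by [M > 0] somewhere, then for small
   [e > 0] the function [u + e (x^2 + y^2)], of Laplacian [4 e > 0], would have an
   interior maximum on a large square. *)
Lemma harmonic_le_limit (u ux uy uxx uyy : R -> R -> R) (c : R) :
  (forall x y : R, is_derive x 1 (fun s => u s y) (ux x y)) ->
  (forall x y : R, is_derive x 1 (fun s => ux s y) (uxx x y)) ->
  (forall x y : R, is_derive y 1 (u x) (uy x y)) ->
  (forall x y : R, is_derive y 1 (uy x) (uyy x y)) ->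
  (forall x y : R, uxx x y + uyy x y = 0) ->
  continuous (fun t : R * R => u t.1 t.2) ->
  (forall e : R, 0 < e -> exists r : R, forall x y : R, r <= `|x| \/ r <= `|y| -> u x y - c <= e) ->
  forall x y : R, u x y <= c.
Proof.
move=> dux duxx duy duyy lap cu lim x0 y0; rewrite leNgt; apply/negP => uc.
pose M := u x0 y0 - c; have M0 : 0 < M by rewrite subr_gt0.
have [r0 hr0] := lim (M / 2) (divr_gt0 M0 (ltr0Sn _ 1)).
pose r := Num.max r0 1.
have rP : 0 < r by rewrite lt_max ltr01 orbT.
have hr (x y : R) : r <= `|x| \/ r <= `|y| -> u x y - c <= M / 2.
  by move=> h; apply: hr0; case: h => h; [left|right]; apply: le_trans h; rewrite le_max lexx.
have x0r : `|x0| < r.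
  by rewrite ltNge; apply/negP => h; have := hr x0 y0 (or_introl h); rewrite -/M; lra.
have y0r : `|y0| < r.
  by rewrite ltNge; apply/negP => h; have := hr x0 y0 (or_intror h); rewrite -/M; lra.
(* On the square the added term is at most 2 e r^2 = M / 4. At a maximum of [w] the value is at
   least c + M, so u is at least c + 3 M / 4 there, whereas u is at most c + M / 2 on the boundary:
   the maximum is interior. *)
pose e := M / (8 * r ^+ 2).
have r20 : 0 < r ^+ 2 by rewrite exprn_gt0.
have e0 : 0 < e by rewrite divr_gt0 // mulr_gt0.
have er : e * r ^+ 2 = M / 8.
  by rewrite /e; move: (lt0r_neq0 r20); move: (r ^+ 2) => R2 h; field.
pose w (t : R * R) := u t.1 t.2 + e * (t.1 * t.1 + t.2 * t.2).
pose K : set (R * R) := `[- r, r]%classic `*` `[- r, r]%classic.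
have Kne : K !=set0.
  by exists (0, 0); split; rewrite /= in_itv /= oppr_le0 ltW.
have Kc : compact K by apply: compact_setX; exact: segment_compact.
have wc : {within K, continuous w}.
  apply: continuous_subspaceT => t; apply: cvgD; first exact: cu.
  apply: cvgM; first exact: cvg_cst.
  by apply: cvgD; apply: cvgM; (exact: cvg_fst || exact: cvg_snd).
have [[x1 y1] K1 max1] := compact_EVT_max Kne Kc wc.
have inK (x y : R) : `|x| <= r -> `|y| <= r -> w (x, y) <= w (x1, y1).
  move=> xr yr; apply: max1; rewrite inE; split; rewrite /= in_itv /= -ler_norml //.
have sq (x : R) : `|x| <= r -> x * x <= r ^+ 2.
  by move=> xr; rewrite -expr2 -real_normK ?num_real // lerXn2r ?nnegrE // ltW.
have w0 : c + M <= w (x0, y0).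
  rewrite /w /= /M; have : 0 <= e * (x0 * x0 + y0 * y0).
    by apply: mulr_ge0; [exact: ltW | rewrite -!expr2 addr_ge0 ?sqr_ge0].
  lra.
have w01 := inK x0 y0 (ltW x0r) (ltW y0r).
have [x1r y1r] : `|x1| <= r /\ `|y1| <= r.
  by move: K1; rewrite inE => -[/=]; rewrite !in_itv /= !ler_norml.
have w1 : w (x1, y1) <= u x1 y1 + M / 4.
  have : e * (x1 * x1 + y1 * y1) <= e * (r ^+ 2 + r ^+ 2).
    by rewrite ler_pM2l // lerD // sq.
  by rewrite (mulrDr e (r ^+ 2)) er /w /=; lra.
have x1r' : `|x1| < r.
  by rewrite ltNge; apply/negP => h; have := hr x1 y1 (or_introl h); lra.
have y1r' : `|y1| < r.
  by rewrite ltNge; apply/negP => h; have := hr x1 y1 (or_intror h); lra.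
have sqd (a t : R) : is_derive t (1 : R) (fun s : R => a + e * (s * s)) (e * (t + t)).
  have lin : is_derive t (1 : R) (id : R -> R) 1 by exact: is_derive_id.
  have := is_deriveD (is_derive_cst (a : R) t (1 : R)) (is_deriveZ e (is_deriveM lin lin)).
  by rewrite add0r [X in is_derive _ _ _ X](_ : _ = e * (t + t)) // /GRing.scale /= !mulr1.
have lind (t : R) : is_derive t (1 : R) (fun s : R => e * (s + s)) (e + e).
  have lin : is_derive t (1 : R) (id : R -> R) 1 by exact: is_derive_id.
  have := is_deriveZ e (is_deriveD lin lin).
  by rewrite [X in is_derive _ _ _ X](_ : _ = e + e) // /GRing.scale /= mulrDr !mulr1.
have close (a t : R) : `|t - a| < r - `|a| -> `|t| <= r.
  move=> h; have -> : t = (t - a) + a by ring.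
  by apply: le_trans (ler_normD _ _) _; lra.
have hx : uxx x1 y1 + (e + e) <= 0.
  have r1 : 0 < r - `|x1| by rewrite subr_gt0.
  apply: (second_derivative_at_max r1
    (fun s _ => is_deriveD (dux s y1) (sqd (e * (y1 * y1)) s))
    (is_deriveD (duxx x1 y1) (lind x1))) => s /close sr.
  have := inK s y1 sr y1r; rewrite /w /= !fctE !mulrDr.
  by rewrite ![e * (y1 * y1) + _]addrC.
have hy : uyy x1 y1 + (e + e) <= 0.
  have r1 : 0 < r - `|y1| by rewrite subr_gt0.
  apply: (second_derivative_at_max r1
    (fun s _ => is_deriveD (duy x1 s) (sqd (e * (x1 * x1)) s))
    (is_deriveD (duyy x1 y1) (lind y1))) => s /close sr.
  by have := inK x1 s x1r sr; rewrite /w /= !fctE !mulrDr.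
have := lap x1 y1; lra.
Qed.

End MaximumPrinciple.

(** * Additivity on the fibres from the behaviour on complex lines *)

Section HolomorphicHomogeneous.
Variables (R : realType) (n : nat).
Local Notation C := (Cplx R).
Local Notation vec := ('rV[Cplx R]_n).
Local Notation T := ('rV[Cplx R]_n * 'rV[Cplx R]_n)%type.
Local Notation Re x := (complex.Re x).
Local Notation Im x := (complex.Im x).
Variables (D : set vec) (oD : open D) (f : T -> C).
Local Notation O := (slit_tangent D).
Let oO : open O := open_slit_tangent oD.
Hypotheses (sf : csmooth O f)
  (fhol : forall h p, O p -> detab h f p = 0)
  (fhom : forall c p, D p.1 -> f (fscale c p) = c * f p).
Implicit Types (p : T) (v eta : vec).

Let phi p := Re (f p).
Let psi p := Im (f p).

Lemma Cauchy_Riemann p v : O p ->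
  rderive psi (iC R *: (0, v)) p = rderive phi (0, v) p /\
  rderive phi (iC R *: (0, v)) p = - rderive psi (0, v) p.
Proof.
move=> Op; have := wirtb_fiber oO Op v sf.
rewrite big1 => [|k _]; last by rewrite fhol // mul0r.
rewrite /wirtb /cderive -/phi -/psi => e.
have {}e : toC (rderive phi (0, v) p) + iC R * toC (rderive psi (0, v) p) +
    iC R * (toC (rderive phi (iC R *: (0, v)) p) + iC R * toC (rderive psi (iC R *: (0, v)) p)) = 0.
  have two0 : (2 : C)^-1 != 0 by rewrite invr_eq0 pnatr_eq0.
  by apply: (mulIf two0); rewrite mul0r -[RHS]e.
have er := congr1 (fun z : C => Re z) e; have ei := congr1 (fun z : C => Im z) e.
move: er ei.
generalize (rderive phi (0, v) p) (rderive psi (0, v) p)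
  (rderive phi (iC R *: (0, v)) p) (rderive psi (iC R *: (0, v)) p) => a b c d.
by rewrite !ReImE => er ei; split; lra.
Qed.

(** The hypothesis says that A + i B is the inverse of c. *)
Lemma scale_expansion (r s : vec) (c A B : C) : c * A + c * B * iC R = 1 ->
  r + c *: s = c *: (s + A *: r + B *: (iC R *: r)).
Proof.
move=> e; rewrite -addrA (scalerA B) -scalerDl scalerDr scalerA mulrDr [c * (B * _)]mulrA e.
by rewrite scale1r addrC.
Qed.

Section Independent.
Variables (z v eta : vec).
Hypotheses (Dz : D z) (v0 : v != 0)
  (indep : forall x y : R, eta + (toC x + iC R * toC y) *: v != 0).

Let V : T := (0, v).
Let W : T := iC R *: V.
Let P (x y : R) : T := (z, eta) + toC x *: V + toC y *: W.

Lemma indep_plane x y : O (P x y).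
Proof.
split; first by rewrite /= !scaler0 !addr0.
by rewrite /= -addrA scalerA -scalerDl [_ * iC R]mulrC.
Qed.

(** With t = x + i y this is eta + t v = t (v + eta / t), where 1 / t = (x - i y) / (x^2 + y^2):
    infinity on the line is moved to the point v. *)
Lemma plane_fscale (x y : R) : 0 < x ^+ 2 + y ^+ 2 ->
  P x y = fscale (toC x + iC R * toC y)
    ((z, v) + toC (x / (x ^+ 2 + y ^+ 2)) *: (0, eta)
      + toC (- y / (x ^+ 2 + y ^+ 2)) *: (iC R *: (0, eta))).
Proof.
move=> N0; apply: injective_projections; first by rewrite /= !scaler0 !addr0.
rewrite /= -addrA (scalerA (toC y)) -scalerDl [_ * iC R]mulrC.
apply: scale_expansion; have N0' := lt0r_neq0 N0.
by apply: CplxP; rewrite !ReImE; field.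
Qed.

Lemma independent_add_Re : phi (z, eta + v) = phi (z, eta) + phi (z, v).
Proof.
(* [x * a - y * b] is the real part of t f(v), and [c] is the real part of the derivative of f at v
   along eta, the expected limit of [u] at infinity. *)
pose a := phi (z, v); pose b := psi (z, v).
pose c := rderive phi (0, eta) (z, v).
pose u (x y : R) := phi (P x y) - (x * a - y * b).
have Ozv : O (z, v) by [].
have Ck_phi k : Ck k O phi := sf.1 k.
have Ck_psi k : Ck k O psi := sf.2 k.
have xline (g : T -> R) (x y : R) : (forall p, O p -> rderivable g p V) ->
    is_derive x 1 (fun s => g (P s y)) (rderive g V (P x y)).
  move=> dg; have e : P x y = ((z, eta) + toC y *: W) + toC x *: V by rewrite /P addrAC.
  have -> : (fun s => g (P s y)) = real_line g ((z, eta) + toC y *: W) V.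
    by apply/funext => s; rewrite /real_line /P addrAC.
  by rewrite e; apply: is_derive_line; rewrite -e; apply: dg; exact: indep_plane.
have yline (g : T -> R) (x y : R) : (forall p, O p -> rderivable g p W) ->
    is_derive y 1 (fun s => g (P x s)) (rderive g W (P x y)).
  by move=> dg; apply: is_derive_line; apply: dg; exact: indep_plane.
have linx (A B s : R) : is_derive s 1 (fun s : R => s * A - B) A.
  have := is_deriveB (is_deriveM (is_derive_id s (1 : R)) (is_derive_cst A s (1 : R)))
    (is_derive_cst B s (1 : R)).
  rewrite [X in is_derive _ _ _ X](_ : _ = A) //.
  by rewrite /GRing.scale /=; ring.
have liny (A B s : R) : is_derive s 1 (fun s : R => A - s * B) (- B).
  have := is_deriveB (is_derive_cst A s (1 : R))
    (is_deriveM (is_derive_id s (1 : R)) (is_derive_cst B s (1 : R))).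
  rewrite [X in is_derive _ _ _ X](_ : _ = - B) //.
  by rewrite /GRing.scale /=; ring.
have dux (x y : R) : is_derive x 1 (fun s => u s y) (rderive phi V (P x y) - a).
  exact (is_deriveB (xline phi x y (fun p Op => Ck_rderivable (Ck_phi 1%N) Op)) (linx a (y * b) x)).
have duy (x y : R) : is_derive y 1 (u x) (rderive phi W (P x y) - - b).
  exact (is_deriveB (yline phi x y (fun p Op => Ck_rderivable (Ck_phi 1%N) Op)) (liny (x * a) b y)).
have dd (g : R -> R) (d k t : R) : is_derive t 1 g d -> is_derive t 1 (fun s => g s - k) d.
  move=> dg; have := is_deriveB dg (is_derive_cst k t (1 : R)).
  by rewrite subr0.
have duxx (x y : R) : is_derive x 1 (fun s => rderive phi V (P s y) - a)
    (rderive (rderive phi V) V (P x y)).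
  exact (dd _ _ a x (xline (rderive phi V) x y
    (fun p Op => Ck_rderivable (Ck_rderive V (Ck_phi 2%N)) Op))).
have duyy (x y : R) : is_derive y 1 (fun s => rderive phi W (P x s) - - b)
    (rderive (rderive phi W) W (P x y)).
  exact (dd _ _ (- b) y (yline (rderive phi W) x y
    (fun p Op => Ck_rderivable (Ck_rderive W (Ck_phi 2%N)) Op))).
(* The Cauchy-Riemann equations turn the Laplacian of [phi] into a difference of mixed derivatives
   of [psi]. *)
have lap (x y : R) : rderive (rderive phi V) V (P x y) + rderive (rderive phi W) W (P x y) = 0.
  have OP := indep_plane x y.
  have e1 : rderive (rderive phi V) V (P x y) = rderive (rderive psi W) V (P x y).
    by apply: (near_eq_rderive V oO OP _).2 => q Oq; rewrite (Cauchy_Riemann v Oq).1.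
  have e2 : rderive (rderive phi W) W (P x y) = - rderive (rderive psi V) W (P x y).
    rewrite -rderiveN_junk; apply: (near_eq_rderive W oO OP _).2 => q Oq.
    by rewrite (Cauchy_Riemann v Oq).2.
  by rewrite e1 e2 (Clairaut W V oO (Ck_psi 2%N) OP) subrr.
have cu : continuous (fun t : R * R => u t.1 t.2).
  move=> t; apply: cvgB.
    apply: (@continuous_comp _ _ _ (fun t : R * R => P t.1 t.2) phi).
      exact: continuous_plane.
    by apply: (Ck_continuous (Ck_phi 0%N)); exact: indep_plane.
  apply: cvgB; apply: cvgM.
  - exact: cvg_fst.
  - exact: cvg_cst.
  - exact: cvg_snd.
  - exact: cvg_cst.
have lim (e : R) : 0 < e ->
    exists r : R, forall x y : R, r <= `|x| \/ r <= `|y| -> `|u x y - c| <= e.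
  (* The final error is (e / 2) (|x| + |y|)^2 / N, and (|x| + |y|)^2 is at most 2 N. *)
  move=> e0; have e20 : 0 < e / 2 by rewrite divr_gt0.
  have [d1 d10 h1] := C1_plane (0, eta) (iC R *: (0, eta)) oO (Ck_phi 1%N) Ozv e20.
  have [d2 d20 h2] := C1_plane (0, eta) (iC R *: (0, eta)) oO (Ck_psi 1%N) Ozv e20.
  pose d := Num.min d1 d2; have d0 : 0 < d by rewrite lt_min d10.
  (* Then N is at least 4 / d^2, so |x| / N and |y| / N are at most d / 2; the factor 2 makes the
     bound by d strict. *)
  exists (2 / d) => x y xy.
  pose N := x ^+ 2 + y ^+ 2.
  have rN : (2 / d) ^+ 2 <= N.
    have r0 : 0 <= 2 / d by rewrite divr_ge0 // ltW.
    rewrite /N; case: xy => h.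
      apply: le_trans (_ : x ^+ 2 <= _); last by rewrite lerDl sqr_ge0.
      by rewrite -[x ^+ 2]real_normK ?num_real // lerXn2r ?nnegrE.
    apply: le_trans (_ : y ^+ 2 <= _); last by rewrite lerDr sqr_ge0.
    by rewrite -[y ^+ 2]real_normK ?num_real // lerXn2r ?nnegrE.
  have N0 : 0 < N by apply: lt_le_trans rN; rewrite exprn_gt0 // divr_gt0.
  have small (s : R) : s ^+ 2 <= N -> `|s / N| < d.
    move=> sN; rewrite normrM normfV (gtr0_norm N0) ltr_pdivrMr //.
    have dN : 0 <= d * N by apply: mulr_ge0; exact: ltW.
    rewrite -(@ltr_pXn2r _ 2) ?nnegrE ?normr_ge0 //.
    rewrite real_normK ?num_real //; apply: le_lt_trans sN _.
    rewrite exprMn expr2 mulrA -[X in X < _]mul1r ltr_pM2r //.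
    have : (2 / d) ^+ 2 * d ^+ 2 = 4.
      by rewrite -exprMn divfK ?gt_eqF // expr2 -natrM.
    have d20' : 0 < d ^+ 2 by rewrite exprn_gt0.
    have : (2 / d) ^+ 2 * d ^+ 2 <= N * d ^+ 2 by rewrite ler_pM2r.
    by rewrite [N * _]mulrC; lra.
  have xs : `|x / N| < d by apply: small; rewrite /N lerDl sqr_ge0.
  have ys : `|- y / N| < d by apply: small; rewrite sqrrN /N lerDr sqr_ge0.
  have dd1 (s : R) : `|s| < d -> `|s| < d1 by rewrite lt_min => /andP[].
  have dd2 (s : R) : `|s| < d -> `|s| < d2 by rewrite lt_min => /andP[].
  have := h1 _ _ (dd1 _ xs) (dd1 _ ys); have := h2 _ _ (dd2 _ xs) (dd2 _ ys).
  have [cr1 cr2] := Cauchy_Riemann eta Ozv.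
  rewrite cr1 cr2 -/c.
  rewrite /u (plane_fscale N0) -/N.
  set q := _ + _ *: (iC R *: _).
  have qD : D q.1 by rewrite /q /= !scaler0 !addr0.
  have -> : phi (fscale (toC x + iC R * toC y) q) = x * phi q - y * psi q.
    rewrite /phi /psi (fhom _ qD); generalize (f q) => w.
    by rewrite !ReImE; ring.
  rewrite -/a -/b.
  move: (rderive psi (0, eta) (z, v)) (phi q) (psi q) => B X Y.
  set E2 := (X in `|X| <= _); set E1 := (X in _ -> `|X| <= _ -> _) => hE2 hE1.
  have N0' : N != 0 by rewrite gt_eqF.
  (* [E1] and [E2] are the first-order remainders of [phi] and [psi] at (z, v). After Cauchy-Riemann
     the terms in [B] cancel, and those in [c] have total weight (x^2 + y^2) / N = 1. *)
  have -> : x * X - y * Y - (x * a - y * b) - c = x * E1 - y * E2.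
    by move: N0'; rewrite /E1 /E2 /N => N0'; field.
  apply: le_trans (ler_normB _ _) _; rewrite !normrM.
  have hx := ler_wpM2l (normr_ge0 x) hE1; have hy := ler_wpM2l (normr_ge0 y) hE2.
  apply: le_trans (lerD hx hy) _; rewrite -mulrDl !normrM normrN normfV (gtr0_norm N0) -mulrDl.
  have -> : (`|x| + `|y|) * (e / 2 * ((`|x| + `|y|) / N)) = e / 2 * (`|x| + `|y|) ^+ 2 / N.
    by rewrite expr2; field.
  rewrite ler_pdivrMr // -mulrA ler_pM2l // ler_pdivrMl //.
  have : 0 <= (`|x| - `|y|) ^+ 2 by exact: sqr_ge0.
  rewrite sqrrB sqrrD /N -[x ^+ 2]real_normK ?num_real // -[y ^+ 2]real_normK ?num_real //.
  by lra.
have uc (x y : R) : u x y = c.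
  apply/eqP; rewrite eq_le; apply/andP; split.
    apply: (harmonic_le_limit dux duxx duy duyy lap cu) => e /lim[r hr].
    by exists r => x' y' /hr; exact/le_trans/ler_norm.
  rewrite -lerN2.
  apply: (harmonic_le_limit (fun x y => is_deriveN (dux x y)) (fun x y => is_deriveN (duxx x y))
    (fun x y => is_deriveN (duy x y)) (fun x y => is_deriveN (duyy x y)) _ _ _ x y).
  - by move=> x' y'; rewrite -opprD lap oppr0.
  - by move=> t; apply: cvgN; exact: cu.
  move=> e /lim[r hr]; exists r => x' y' /hr; apply: le_trans.
  by rewrite -opprD ler_normlW // normrN.
have := uc 0 0; rewrite -(uc 1 0) /u.
have -> : P 0 0 = (z, eta) by rewrite /P toC0 !scale0r !addr0.
have -> : P 1 0 = (z, eta + v).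
  rewrite /P toC0 toC1 scale0r scale1r addr0.
  by apply: injective_projections; rewrite /= ?addr0.
by rewrite -/a; lra.
Qed.

End Independent.

Lemma fiberwise_scale z c eta : D z -> f (z, c *: eta) = c * f (z, eta).
Proof. exact: (fhom c (p := (z, eta))). Qed.

Lemma fiberwise_add z eta v : D z -> f (z, eta + v) = f (z, eta) + f (z, v).
Proof.
move=> Dz; have f0 : f (z, 0) = 0 by rewrite -(scale0r (0 : vec)) fiberwise_scale // mul0r.
have [->|v0] := eqVneq v 0; first by rewrite f0 !addr0.
have [[c ->]|nc] := pselect (exists c : C, eta = c *: v).
  by rewrite -{2}[v]scale1r -scalerDl !fiberwise_scale // mulrDl mul1r.
(* Taking d = 1 gives the real part of additivity, and d = i the imaginary part, since Re (i w) = -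
   Im w. *)
have add_Re (d : C) : d != 0 ->
    phi (z, d *: (eta + v)) = phi (z, d *: eta) + phi (z, d *: v).
  move=> d0; rewrite scalerDr; apply: independent_add_Re => //.
    by rewrite scaler_eq0 negb_or d0.
  move=> x y; rewrite scalerA mulrC -scalerA -scalerDr scaler_eq0 negb_or d0 /=.
  apply/eqP => /eqP; rewrite addr_eq0 -scaleNr => /eqP e.
  by apply: nc; eexists; exact: e.
have := add_Re _ (iC_neq0 R); have := add_Re _ (oner_neq0 C).
rewrite !scale1r /phi !fiberwise_scale //.
move: (f (z, eta + v)) (f (z, eta)) (f (z, v)) => r s t.
by rewrite !ReImE => er ei; apply: CplxP; rewrite !ReImE; lra.
Qed.

Lemma fiberwise_linear z eta : D z ->
  f (z, eta) = \sum_k f (z, unit_vec R k) * eta 0 k.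
Proof.
move=> Dz; rewrite [in LHS](row_sum_delta eta); elim: index_enum => [|k r ih].
  by rewrite !big_nil -(scale0r (0 : vec)) fiberwise_scale // mul0r.
by rewrite !big_cons fiberwise_add // fiberwise_scale // ih; congr (_ + _); exact: mulrC.
Qed.

End HolomorphicHomogeneous.

(** * Projective flatness *)

Section HomogeneousAcrossZero.
Variables (R : realType) (n : nat).
Local Notation C := (Cplx R).
Local Notation vec := ('rV[Cplx R]_n).
Local Notation T := ('rV[Cplx R]_n * 'rV[Cplx R]_n)%type.
Local Notation Re x := (complex.Re x).
Local Notation Im x := (complex.Im x).

(** Used with a = 0 for a function of degree 1 and with b = 0 for a derivative of degree 0. *)
Lemma limit_at_zero_section (g : T -> R) (z eta : vec) (a b : R) :
  {for (z, 0), continuous g} ->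
  (forall t : R, 0 < t -> g (z, toC t *: eta) = a + t * b) -> g (z, 0) = a.
Proof.
move=> cg gE; pose h (t : R) := g ((z, 0) + toC t *: (0, eta)).
have e0 : (z, 0) + toC 0 *: (0, eta) = (z, 0) :> T by rewrite toC0 scale0r addr0.
have ch : h t @[t --> (0 : R)^'+] --> g (z, 0).
  apply: cvg_at_right_filter.
  have -> : g (z, 0) = h 0 by rewrite /h e0.
  apply: (@continuous_comp _ _ _ (fun t : R => (z, 0) + toC t *: ((0, eta) : T)) g).
    exact: continuous_line.
  by rewrite e0.
have ca : h t @[t --> (0 : R)^'+] --> a.
  have : a + t * b @[t --> (0 : R)^'+] --> a + 0 * b.
    apply: cvg_at_right_filter; apply: cvgD; first exact: cvg_cst.
    by apply: cvgM; [exact: cvg_id | exact: cvg_cst].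
  rewrite mul0r addr0; apply: cvg_trans; apply: near_eq_cvg.
  near=> t; have t0 : 0 < t by near: t; exact: nbhs_right_gt.
  rewrite /h -gE //; congr g.
  by apply: injective_projections; rewrite /= ?scaler0 ?addr0 ?add0r.
exact: (cvg_unique _ ch ca).
Unshelve. all: by end_near. Qed.

Variables (D : set vec) (oD : open D) (f : T -> C).
Local Notation O := (slit_tangent D).
Let oO : open O := open_slit_tangent oD.
Hypotheses (sf : csmooth (tangent D) f)
  (fhom : forall c p, c != 0 -> O p -> f (fscale c p) = c * f p).

(* The derivative along [(0, v)] is homogeneous of degree 0 and continuous at the
   zero section, hence constant on each fibre. *)
Lemma rderive_real_homogeneous (g : T -> R) (z eta v : vec) :
  Ck 1 (tangent D) g ->
  (forall (t : R) p, 0 < t -> O p -> g (fscale (toC t) p) = t * g p) ->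
  (forall p, O p -> g (fscale (-1) p) = - g p) ->
  D z -> eta != 0 -> v != 0 -> rderive g (0, v) (z, eta) = g (z, v).
Proof.
move=> g1 ghom gneg Dz eta0 v0.
have Ozv : O (z, v) by []. have Oze : O (z, eta) by [].
have tz : tangent D (z, 0) by [].
have gz : g (z, 0) = 0.
  apply: (limit_at_zero_section (b := g (z, v)) (eta := v) (Ck_continuous g1 tz)) => t t0.
  by rewrite add0r -ghom.
(* The derivative at the zero section is two-sided, so negative t matter; the hypothesis on
   [fscale (-1)] supplies them. *)
have gline (t : R) : g (z, toC t *: v) = t * g (z, v).
  have [t0|t0|->] := ltgtP t 0.
  - have nt : 0 < - t by rewrite oppr_gt0.
    have Ov : O (fscale (toC (- t)) (z, v)).
      by apply: fscale_slit => //; rewrite toC_eq0 gt_eqF.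
    have -> : (z, toC t *: v) = fscale (-1) (fscale (toC (- t)) (z, v)).
      by rewrite /fscale /= scalerA mulN1r toCN opprK.
    by rewrite gneg // ghom // mulNr opprK.
  - by rewrite -ghom.
  - by rewrite toC0 scale0r mul0r.
have dz0 : rderive g (0, v) (z, 0) = g (z, v).
  rewrite /rderive derive1E.
  have -> : real_line g (z, 0) (0, v) = fun t => t * g (z, v).
    apply/funext => t; rewrite -gline /real_line; congr g.
    by apply: injective_projections; rewrite /= ?scaler0 ?addr0 ?add0r.
  have := is_deriveM (is_derive_id (0 : R) (1 : R)) (is_derive_cst (g (z, v)) (0 : R) (1 : R)).
  move=> d; rewrite [LHS](@derive_val _ _ _ _ _ _ _ d) /GRing.scale /=; ring.
rewrite -dz0; apply/esym.
apply: (limit_at_zero_section (b := 0) (eta := eta)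
  (Ck_continuous (Ck_rderive (0, v) g1) tz)) => t t0.
rewrite mulr0 addr0; apply: (mulfI (lt0r_neq0 t0)).
have Ot : O (fscale (toC t) (z, eta)).
  by apply: fscale_slit => //; rewrite toC_eq0 gt_eqF.
have dt : rderivable g (fscale (toC t) (z, eta)) (0, v).
  by apply: (Ck_rderivable g1); exact: Ot.1.
rewrite -(rderiveZv t dt).2.
have -> : toC t *: (0, v) = fscale (toC t) (0, v) :> T.
  by apply: injective_projections; rewrite //= scaler0.
rewrite /rderive -(rderive_comp_affine g _ _ (fscale_affine (toC t))).
transitivity (rderive (fun q => t * g q) (0, v) (z, eta)).
  apply: (near_eq_rderive (0, v) oO Oze _).2 => q Oq; exact: ghom.
have dg : rderivable g (z, eta) (0, v) by apply: (Ck_rderivable g1).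
have dc := (rderive_cst t ((z, eta) : T) (0, v)).
by rewrite (rderiveM dc.1 dg).2 dc.2 mulr0 addr0.
Qed.

Lemma cderive_homogeneous (z eta v : vec) : D z -> eta != 0 -> v != 0 ->
  cderive f (0, v) (z, eta) = f (z, v).
Proof.
move=> Dz eta0 v0; have [rf mf] := sf.
rewrite /cderive.
have t0C (t : R) : 0 < t -> toC t != 0 by move=> t0; rewrite toC_eq0 gt_eqF.
have n1 : -1 != 0 :> C by rewrite oppr_eq0 oner_eq0.
rewrite (rderive_real_homogeneous (rf 1%N)) //; first last.
- by move=> p Op; rewrite fhom // !ReImE; ring.
- by move=> t p tp Op; rewrite fhom ?t0C // !ReImE; ring.
rewrite (rderive_real_homogeneous (mf 1%N)) //; first last.
- by move=> p Op; rewrite fhom // !ReImE; ring.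
- by move=> t p tp Op; rewrite fhom ?t0C // !ReImE; ring.
by rewrite -CplxE.
Qed.

(** The derivative along a fibre vector is the value of f at that vector, so the operator gives
    (f(e) + i f(i e)) / 2 = (f(e) - f(e)) / 2. *)
Lemma detab_homogeneous h p : O p -> detab h f p = 0.
Proof.
case: p => z eta [/= Dz eta0].
have e0 : unit_vec R h != 0.
  by apply/eqP => /rowP /(_ h) /eqP; rewrite unit_vecE mxE eqxx oner_eq0.
have ie : iC R *: (0, unit_vec R h) = (0, iC R *: unit_vec R h) :> T.
  by apply: injective_projections; rewrite /= ?scaler0.
rewrite /detab /wirtb ie !cderive_homogeneous //; last first.
  by rewrite scaler_eq0 negb_or iC_neq0.
have -> : f (z, iC R *: unit_vec R h) = iC R * f (z, unit_vec R h).
  by apply: (fhom (p := (z, unit_vec R h))) => //; exact: iC_neq0.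
by rewrite mulrA iCiC mulN1r subrr mul0r.
Qed.

End HomogeneousAcrossZero.

Lemma continuous_pair (S U V : topologicalType) (f : S -> U) (g : S -> V) :
  continuous f -> continuous g -> continuous (fun x => (f x, g x)).
Proof. by move=> cf cg x; exact: (cvg_pair (cf x) (cg x)). Qed.

(** * Locally Minkowski metrics and frozen metrics *)

Section LocallyMinkowski.
Variables (R : realType) (n : nat).
Local Notation C := (Cplx R).
Local Notation vec := ('rV[Cplx R]_n).
Local Notation T := ('rV[Cplx R]_n * 'rV[Cplx R]_n)%type.

Section Chart.
Variables (D : set vec) (oD : open D) (F : T -> R).
Hypothesis hF : complex_Finsler D F.
Local Notation O := (slit_tangent D).
Let oO : open O := open_slit_tangent oD.
Variables (A : 'M[C]_n) (b : vec).
Let B := invmx A.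
Let Psi (p : T) : T := ((p.1 - b) *m B, p.2 *m B).
Let Psi0 (p : T) : T := (p.1 *m B, p.2 *m B).

Let Psi_affine (p v : T) (t : R) : Psi (p + toC t *: v) = Psi p + toC t *: Psi0 v.
Proof.
apply: injective_projections; rewrite /= scalemxAl -mulmxDl //.
by rewrite addrAC.
Qed.

Let Psi0_iC (v : T) : Psi0 (iC R *: v) = iC R *: Psi0 v.
Proof. by apply: injective_projections; rewrite /= scalemxAl. Qed.

Let Psi0_unit (k : 'I_n) : Psi0 (0, unit_vec R k) = (0, row k B).
Proof. by rewrite /Psi0 /= mul0mx -rowE. Qed.

(** The tensor law of g: both fibre derivatives are taken along rows of [B], one C-linearly and the
    other conjugate-linearly. *)
Lemma fundamental_in_chart w : O (Psi w) ->
  fundamental (in_chart A b F) w =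
  B *m fundamental F (Psi w) *m (map_mx (@conjC R) B)^T.
Proof.
move=> Ow; apply/matrixP => i m.
have sL := sqF_csmooth oD hF; have sdL j := detab_sqF_csmooth oD hF j.
pose h := wirtb (0, row m B) (sqF F).
have hE : detab m (sqF (in_chart A b F)) = fun q => h (Psi q).
  by apply/funext => q; rewrite /detab (wirtb_comp_affine (sqF F) _ _ Psi_affine Psi0_iC) Psi0_unit.
have hO q : O q -> h q = \sum_j detab j (sqF F) q * conjC (B m j).
  move=> Oq; rewrite /h (wirtb_fiber oO Oq _ sL); apply: eq_bigr => j _.
  by rewrite [row _ _ _ _]mxE.
have cs (j : 'I_n) := csmooth_cst (O := O) oO (conjC (B m j)).
have sh : csmooth O h.
  apply: (eq_csmooth oO (fun q Oq => esym (hO q Oq))).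
  by apply: (csmooth_sum oO) => j; exact: (csmoothM oO (sdL j) (cs j)).
rewrite mxE hE /deta (wirt_comp_affine h _ _ Psi_affine Psi0_iC) Psi0_unit.
rewrite (wirt_fiber oO Ow _ sh) mxE.
transitivity (\sum_k \sum_j B i k * fundamental F (Psi w) k j * conjC (B m j)).
  apply: eq_bigr => k _; rewrite [row _ _ _ _]mxE /deta (eq_wirt oO _ Ow hO).
  rewrite (wirt_sum oO Ow) => [|j]; last exact: (csmoothM oO (sdL j) (cs j)).
  rewrite big_distrl; apply: eq_bigr => j _ /=.
  rewrite (wirtM Ow _ (sdL j) (cs j)) wirt_cst mulr0 add0r [fundamental _ _ _ _]mxE.
  by rewrite /deta; move: (wirt _ _ _) (B i k) (conjC _) => x y s; ring.
rewrite exchange_big; apply: eq_bigr => j _ /=.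
by rewrite mxE big_distrl /= !mxE.
Qed.

Lemma map_conjC_unit : A \in unitmx -> (map_mx (@conjC R) B)^T *m (map_mx (@conjC R) A)^T = 1%:M.
Proof.
move=> Au; rewrite -trmx_mul -[RHS]trmx1; congr (_^T); apply/matrixP => i j.
have := congr1 (fun M : 'M[C]_n => conjC (M i j)) (mulmxV Au).
rewrite !mxE conjC_sum; under eq_bigr do rewrite conjCM.
move=> e; transitivity (conjC ((i == j)%:R : C)); first rewrite -e.
  by apply: eq_bigr => k _; rewrite !mxE.
by case: (i == j); rewrite ?conjC0 ?conjC1.
Qed.

(** An affine chart has the same matrix at z and at z', so it cancels from the tensor law and
    independence of z returns to the original coordinates. *)
Lemma fundamental_of_chart (z z' eta : vec) : A \in unitmx -> D z -> D z' -> eta != 0 ->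
  fundamental (in_chart A b F) (z *m A + b, eta *m A) =
  fundamental (in_chart A b F) (z' *m A + b, eta *m A) ->
  fundamental F (z, eta) = fundamental F (z', eta).
Proof.
move=> Au Dz Dz' eta0.
have PsiE (y : vec) : Psi (y *m A + b, eta *m A) = (y, eta).
  by rewrite /Psi /= addrK !mulmxK.
have gE (y : vec) : D y -> fundamental (in_chart A b F) (y *m A + b, eta *m A) =
    B *m fundamental F (y, eta) *m (map_mx (@conjC R) B)^T.
  move=> Dy; have OP : O (Psi (y *m A + b, eta *m A)) by rewrite PsiE.
  by rewrite (fundamental_in_chart OP) PsiE.
rewrite (gE z Dz) (gE z' Dz').
move: (fundamental F (z, eta)) (fundamental F (z', eta)) => g g' e.
have := congr1 (fun M => A *m (M *m (map_mx (@conjC R) A)^T)) e.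
by rewrite -!(mulmxA _ _ (map_mx _ A)^T) map_conjC_unit // !mulmx1 !mulKVmx.
Qed.

End Chart.

Variables (D : set vec) (oD : open D) (F : T -> R).
Local Notation O := (slit_tangent D).

Lemma locally_Minkowski_CF i j p : complex_Finsler D F -> locally_Minkowski D F ->
  O p -> CF F i j p = 0.
Proof.
move=> hF mF [Dp p0]; have [U [A [b [oU Up UD Au cst]]]] := mF _ Dp.
have const z z' eta : U z -> U z' -> eta != 0 -> fundamental F (z, eta) = fundamental F (z', eta).
  move=> Uz Uz' eta0; have etaA0 : eta *m A != 0.
    by apply: contra eta0 => /eqP e; rewrite -(mulmxK Au eta) e mul0mx.
  exact: (fundamental_of_chart oD hF Au (UD _ Uz) (UD _ Uz') eta0
    (cst _ _ _ Uz Uz' etaA0)).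
rewrite /CF big1 // => m _; rewrite big1 // => l _.
suff -> : dz j (fun q => fundamental F q l m) p = 0 by rewrite mulr0 mul0r.
have oT : open (tangent U) := open_tangent oU.
have c (v : vec) : cderive (fun q => fundamental F q l m) (v, 0) p = 0.
  apply: (cderive_quadratic (c0 := fundamental F p l m) (c1 := 0) (c2 := 0) oT Up) => t Ut.
  suff -> : fundamental F (p + toC t *: (v, 0)) = fundamental F p.
    by move: (fundamental F p l m) => x; ring.
  case: p Dp p0 Up Ut => z eta /= Dp p0 Up Ut.
  have -> : (z, eta) + toC t *: (v, 0) = (z + toC t *: v, eta) :> T.
    by apply: injective_projections; rewrite /= ?scaler0 ?addr0.
  exact: const.
rewrite /dz /wirt c; have -> : iC R *: (unit_vec R j, 0 : vec) = (iC R *: unit_vec R j, 0).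
  by apply: injective_projections; rewrite /= ?scaler0.
by rewrite c mulr0 subr0 mul0r.
Qed.

Lemma spray_eq0 i p : (forall i j q, O q -> CF F i j q = 0) -> O p -> spray F i p = 0.
Proof.
by move=> CF0 Op; rewrite /spray big1 ?mul0r // => j _; rewrite CF0 // mul0r.
Qed.

Lemma theta_eq0 i p : (forall i j q, O q -> CF F i j q = 0) -> O p -> theta F i p = 0.
Proof.
move=> CF0 Op.
have CFL0 r j m : CFL F r j m p = 0.
  by rewrite /CFL /deta (eq_wirt (open_slit_tangent oD) _ Op (CF0 r m)) wirt_cst.
rewrite /theta big1 // => m _; rewrite big1 // => h _; rewrite big1 // => r _.
by rewrite big1 // => j _; rewrite !CFL0 subrr mulr0 !mul0r.
Qed.

Section Frozen.
Variable z0 : vec.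
Hypotheses (Dz0 : D z0) (hF : complex_Finsler D F).
Let F0 (p : T) := F (z0, p.2).
Let at0 (p : T) : T := (z0, p.2).
Let at00 (p : T) : T := (0, p.2).

Let at0_affine (p v : T) (t : R) : at0 (p + toC t *: v) = at0 p + toC t *: at00 v.
Proof. by apply: injective_projections; rewrite //= scaler0 addr0. Qed.

Let at00_iC (v : T) : at00 (iC R *: v) = iC R *: at00 v.
Proof. by apply: injective_projections; rewrite //= scaler0. Qed.

Let at0_continuous : continuous at0.
Proof.
by apply: continuous_pair => p; [exact: cvg_cst | exact: cvg_snd].
Qed.

Lemma fundamental_frozen p : fundamental F0 p = fundamental F (at0 p).
Proof.
apply/matrixP => i j; rewrite [LHS]mxE [RHS]mxE.
have -> : detab j (sqF F0) = fun q => detab j (sqF F) (at0 q).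
  by apply/funext => q; exact: (wirtb_comp_affine (sqF F) _ _ at0_affine at00_iC).
exact: (wirt_comp_affine (detab j (sqF F)) _ _ at0_affine at00_iC).
Qed.

Lemma frozen_Finsler : complex_Finsler D F0.
Proof.
have [cF sF pF hom posF] := hF; split.
- move=> p Dp; apply: (@continuous_comp _ _ _ at0 F); first exact: at0_continuous.
  by apply: cF.
- move=> k; apply: (Ck_comp_affine at0_affine at0_continuous _ (sF k)) => p [_ p0].
  by split.
- by move=> z eta _; exact: pF.
- by move=> z eta lambda _; exact: hom.
- by move=> p [Dp p0] v v0; rewrite fundamental_frozen; apply: posF.
Qed.

Lemma frozen_Minkowski : locally_Minkowski D F0.
Proof.
move=> z Dz; exists D, 1%:M, 0.
split; [exact: oD | exact: Dz | by [] | exact: unitmx1 | move=> x x' xi _ _ _].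
have -> : in_chart 1%:M 0 F0 = F0.
  by apply/funext => p; rewrite /in_chart /F0 /= invmx1 mulmx1.
by rewrite !fundamental_frozen; reflexivity.
Qed.

End Frozen.

End LocallyMinkowski.

(** * The spray of a projectively flat metric and the projective factor *)

Section Flatness.
Variables (R : realType) (n : nat).
Local Notation C := (Cplx R).
Local Notation vec := ('rV[Cplx R]_n).
Local Notation T := ('rV[Cplx R]_n * 'rV[Cplx R]_n)%type.
Variables (D : set vec) (oD : open D) (F : T -> R).
Hypothesis hF : complex_Finsler D F.
Local Notation O := (slit_tangent D).
Let oO : open O := open_slit_tangent oD.

Lemma detab_fiber_coord h (i : 'I_n) p : O p -> detab h (fun q : T => q.2 0 i) p = 0.
Proof.
move=> Op; have c (v : T) : cderive (fun q : T => q.2 0 i) v p = v.2 0 i.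
  apply: (cderive_quadratic (c0 := p.2 0 i) (c2 := 0) oO Op) => t _.
  by rewrite /= !mxE mulr0 addr0.
rewrite /detab /wirtb !c /= [in X in _ + _ * X]mxE mulrA iCiC mulN1r subrr.
by rewrite mul0r.
Qed.

Lemma detab_radial_mul h i p : O p ->
  detab h (fun q => radial F q * q.2 0 i) p = p.2 0 i * detab h (radial F) p.
Proof.
move=> Op.
rewrite /detab (wirtbM Op _ (radial_csmooth oD hF) (csmooth_fiber_coord i oO)).
by rewrite -/(detab h _ p) (detab_fiber_coord h i Op) mulr0 add0r.
Qed.

(* Contracting with the metric eliminates [theta] and identifies [P]; rotating
   [eta] by [i] separates [theta], invariant, from the spray, which changes sign. *)
Lemma flat_spray (P : T -> C) :
  (forall i p, O p -> 0 = spray F i p + (0 - theta F i p) / 2 + P p * p.2 0 i) ->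
  forall p, O p -> [/\ P p = - radial F p,
    forall i, theta F i p = 0 & forall i, spray F i p = radial F p * p.2 0 i].
Proof.
move=> rel.
have PE p : O p -> P p = - radial F p.
  move=> Op.
  have L0 : sqF F p != 0.
    by rewrite /sqF expr2 toCM mulf_neq0 // (Finsler_neq0 hF Op).
  (* The relation with its index lowered; Euler's relation turns P eta^i into P times the conjugate
     fibre derivative of F^2. *)
  have row0 r : \sum_i spray F i p * fundamental F p i r - torsion_form F r p / 2
      + P p * detab r (sqF F) p = 0.
    rewrite -(torsion_form_theta hF r Op) -(Euler_fundamental oD hF r Op).
    rewrite big_distrl big_distrr -sumrB -big_split /=.
    apply: big1 => i _.
    transitivity ((spray F i p + (0 - theta F i p) / 2 + P p * p.2 0 i) * fundamental F p i r).
      by move: (spray F i p) (theta F i p) (fundamental F p i r) => x y w; field.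
    by rewrite -(rel i p Op) mul0r.
  have tot : radial F p * sqF F p - 0 / 2 + P p * sqF F p = 0.
    rewrite -[X in X / 2](torsion_form_contract F p) -(spray_contract oD hF Op).
    rewrite -[X in P p * X](Euler_sqF oD hF Op) big_distrl big_distrr -sumrB -big_split /=.
    apply: big1 => r _.
    rewrite -[RHS](mul0r (conjC (p.2 0 r))) -[in RHS](row0 r).
    by move: (\sum_i _) (torsion_form F r p) (detab r (sqF F) p) => x y w; ring.
  apply: (mulIf L0); move: tot.
  move: (radial F p) (sqF F p) (P p) => x y w e.
  by apply/eqP; rewrite -subr_eq0 -[X in _ == X]e; apply/eqP; ring.
move=> p Op.
have th0 i : theta F i p = 0.
  have Oip : O (fscale (iC R) p) := fscale_slit (iC_neq0 R) Op.
  have e1 := rel i p Op; have e2 := rel i _ Oip.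
  rewrite (PE p Op) in e1.
  rewrite (PE _ Oip) (spray_rotation oD hF i Op) (theta_rotation oD hF i Op) in e2.
  rewrite (radial_fscale oD hF) /= ?mxE in e2; last by case: Op.
  move: e1 e2; move: (theta F i p) (spray F i p) (radial F p) (p.2 0 i) => t s r w e1 e2.
  (* The relations at eta and i eta add up to - t - (1 + i^2) r w. The last term compensates the
     second summand, so that the identity is formal and i^2 = -1 enters only afterwards. *)
  transitivity (- ((s + (0 - t) / 2 + - r * w) + (- s + (0 - t) / 2 + - (iC R * r) * (iC R * w)))
     - (iC R * iC R + 1) * r * w); first by field.
  by rewrite -e1 -e2 iCiC; ring.
split=> [|//|i]; first exact: PE.
have := rel i p Op; rewrite th0 (PE p Op).
move: (spray F i p) (radial F p) (p.2 0 i) => x y w e.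
by apply/eqP; rewrite -subr_eq0 [X in _ == X]e; apply/eqP; ring.
Qed.

Lemma unit_vec_neq0 (k : 'I_n) : unit_vec R k != 0.
Proof. by apply/eqP => /rowP /(_ k) /eqP; rewrite unit_vecE mxE eqxx oner_eq0. Qed.

(** The coefficients of the linear form are regular over all of D, because (z, e_k) never meets the
    zero section. *)
Lemma radial_csmooth_base k : csmooth (tangent D) (fun q => radial F (q.1, unit_vec R k)).
Proof.
pose phi0 (p : T) : T := (p.1, 0).
apply: (@csmooth_comp_affine _ _ O (tangent D) (radial F) (fun q => (q.1, unit_vec R k)) phi0).
- by move=> p v t; apply: injective_projections; rewrite //= scaler0 addr0.
- by apply: continuous_pair => p; [exact: cvg_fst | exact: cvg_cst].
- by move=> p Dp; split => //=; exact: unit_vec_neq0.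
- exact: radial_csmooth.
Qed.

Lemma csmooth_fiberwise_linear :
  csmooth (tangent D) (fun q => \sum_k radial F (q.1, unit_vec R k) * q.2 0 k).
Proof.
have oT := open_tangent oD.
apply: (csmooth_sum oT) => k.
exact: (csmoothM oT (radial_csmooth_base k) (csmooth_fiber_coord k oT)).
Qed.

(** At each point some coordinate eta^i is nonzero; that coordinate is holomorphic, so it factors
    out of the derivative of Q eta^i and can be cancelled. *)
Lemma detab_radial h p : generalized_Berwald D F ->
  (forall i q, O q -> spray F i q = radial F q * q.2 0 i) -> O p ->
  detab h (radial F) p = 0.
Proof.
move=> gB sE Op; have [_ p0] := Op; have /rV0Pn[i pi0] := p0.
have := gB h i p Op; rewrite /detab (eq_wirtb oO _ Op (sE i)).
rewrite -/(detab h (fun q => radial F q * q.2 0 i) p) detab_radial_mul // => /eqP.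
by rewrite mulf_eq0 (negbTE pi0) => /eqP.
Qed.

End Flatness.

Theorem theorem2p4 (R : realType) (n : nat) (D : set 'rV[Cplx R]_n)
    (F : 'rV[Cplx R]_n * 'rV[Cplx R]_n -> R)
    (hD : domain D) (hF : complex_Finsler D F) :
  locally_projectively_flat D F <->
  complex_Berwald D F /\
  (forall (i : 'I_n) (z eta : 'rV[Cplx R]_n), D z -> eta != 0 ->
     spray F i (z, eta) =
       (toC (F (z, eta)))^-1 *
       (\sum_k dz k (fun p => toC (F p)) (z, eta) * eta 0 k) * eta 0 i).
Proof.
have [oD _ [z0 Dz0]] := hD; have oO := open_slit_tangent oD; split.
  move=> [F' [hF' mF' [P sP rel]]].
  have CF0 i j q (Oq : slit_tangent D q) := locally_Minkowski_CF oD i j hF' mF' Oq.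
  have flat : forall p, slit_tangent D p -> [/\ P p = - radial F p,
      forall i, theta F i p = 0 & forall i, spray F i p = radial F p * p.2 0 i].
    apply: (flat_spray oD hF) => i p Op.
    by have := rel i p Op; rewrite (spray_eq0 i CF0 Op) (theta_eq0 oD i CF0 Op).
  have Phom c p : c != 0 -> slit_tangent D p -> P (fscale c p) = c * P p.
    move=> c0 Op; have [-> _ _] := flat _ Op.
    have [-> _ _] := flat _ (fscale_slit c0 Op).
    by rewrite (radial_fscale oD hF) ?mulrN //; case: Op.
  have dradial h p : slit_tangent D p -> detab h (radial F) p = 0.
    move=> Op; have PE q : slit_tangent D q -> radial F q = -1 * P q.
      by move=> Oq; have [-> _ _] := flat _ Oq; rewrite mulN1r opprK.
    (* Restriction to a smaller open set is composition with the identity, viewed as an affine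
       map. *)
    have sP' : csmooth (slit_tangent D) P.
      apply: (@csmooth_comp_affine _ _ (tangent D) (slit_tangent D) P id id).
      - by [].
      - by move=> q; exact: cvg_id.
      - by move=> q [].
      - exact: sP.
    rewrite /detab (eq_wirtb oO _ Op PE) (wirtbM Op _ (csmooth_cst oO (-1)) sP').
    by rewrite wirtb_cst -/(detab h P p) (detab_homogeneous oD sP Phom h Op) !mulr0 addr0.
  split; first split.
  - move=> h i p Op; rewrite /detab (eq_wirtb oO (g := fun q => radial F q * q.2 0 i) _ Op).
      by rewrite -/(detab h _ p) (detab_radial_mul oD hF h i Op) dradial // mulr0.
    by move=> q Oq; have [_ _ ->] := flat _ Oq.
  - apply/(weakly_KahlerP hF) => k p Op; rewrite -(torsion_form_theta hF k Op).
    by apply: big1 => i _; have [_ -> _] := flat _ Op; rewrite mul0r.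
  - move=> i z eta Dz eta0.
    have Op : slit_tangent D (z, eta) by [].
    by have [_ _ ->] := flat _ Op.
move=> [[gB wK] formula].
have sE i q : slit_tangent D q -> spray F i q = radial F q * q.2 0 i.
  by case: q => z eta [Dz eta0]; exact: formula.
pose F0 (p : 'rV[Cplx R]_n * 'rV[Cplx R]_n) := F (z0, p.2).
have hF0 : complex_Finsler D F0 := frozen_Finsler Dz0 hF.
have mF0 : locally_Minkowski D F0 := frozen_Minkowski oD F z0.
have CF0 i j q (Oq : slit_tangent D q) := locally_Minkowski_CF oD i j hF0 mF0 Oq.
exists F0; split => //.
(* The factor is - Q, written in its fibrewise linear form: smoothness is required on the zero
   section too, where the formula for [radial] involves the inverse of F. *)
exists (fun q : 'rV[Cplx R]_n * 'rV[Cplx R]_n => - \sum_k radial F (q.1, unit_vec R k) * q.2 0 k).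
  exact: (csmoothN (open_tangent oD) (csmooth_fiberwise_linear oD hF)).
move=> i p Op; rewrite (spray_eq0 i CF0 Op) (theta_eq0 oD i CF0 Op).
have th0 : theta F i p = 0.
  by rewrite theta_raise big1 // => m _; rewrite ((weakly_KahlerP hF).1 wK) // mulr0.
have -> : \sum_k radial F (p.1, unit_vec R k) * p.2 0 k = radial F p.
  case: p Op {th0} => z eta [Dz eta0] /=; apply/esym.
  apply: (fiberwise_linear oD (radial_csmooth oD hF)) => //.
    by move=> h q Oq; exact: (detab_radial oD hF h gB sE Oq).
  by move=> c q Dq; exact: (radial_fscale oD hF).
by rewrite th0 (sE i p Op) subr0 mul0r addr0 mulNr subrr.
Qed.
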